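(* Fix an odd positive integer $\ell$. For $n\ge 3$ and $1\le k\le n$, define $p_\ell^{(k)}:S^{n-1}\to\mathbb{R}$ by $p_\ell^{(k)}(x)=A\,C_\ell^{\frac{n-2}{2}}(x_k)$, where $$A^2=\frac{(n-3)!\,\ell!\,(n+2\ell-2)}{(n+\ell-3)!\,(n-2)}$$ and $C^{\kappa}_\ell$ is the Gegenbauer polynomial $$C^\kappa_\ell(t)=\frac{2^\ell}{\Gamma(\kappa)}\sum_{j=0}^{\lfloor \ell/2\rfloor}\frac{(-1)^j\Gamma(\kappa+\ell-j)}{2^{2j}j!(\ell-2j)!}t^{\ell-2j}.$$ Then there is a constant $c$ depending only on $\ell$ such that for every $n\ge3$ and every $\mathbf a=(a_1,\dots,a_n)\in\mathbb{R}^n$ with $\sum a_i^2=1$, the function $p(x)=\sum_{i=1}^n a_ip_\ell^{(i)}(x)$ satisfies $$d_{TV}(p(X),Z)\le c\|\mathbf a\|_4^2,$$ where $X$ is a uniformly random point of $S^{n-1}$, $Z$ is a standard Gaussian random variable, and $\|\mathbf a\|_4=(\sum_i a_i^4)^{1/4}$. Moreover, there is a constant $c'$ depending only on $\ell$ such that if the coefficient vector $\mathbf a$ is chosen uniformly at random from $S^{n-1}$ (independently of $X$), then $$\mathbb{E}\,d_{TV}(p(X),Z)\le\frac{c'}{\sqrt n},$$ where the total variation distance is computed for fixed $\mathbf a$ and the expectation is over $\mathbf a$.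
   Context: $S^{n-1}$ carries the uniform probability measure. Each $p_\ell^{(k)}$ is a spherical harmonic of degree $\ell$ (eigenfunction of the spherical Laplacian with eigenvalue $-\ell(n+\ell-2)$) with $\mathbb{E}[p_\ell^{(k)}(X)^2]=1$. $d_{TV}(X,Y)=\sup_A|\mathbb{P}(X\in A)-\mathbb{P}(Y\in A)|$ over measurable $A$. *)

(* Defs.v *)
From HB Require Import structures.
From mathcomp Require Import all_boot all_order all_algebra.
From mathcomp Require Import all_classical all_reals all_analysis.
Set Implicit Arguments. Unset Strict Implicit. Unset Printing Implicit Defensive.
Import Order.TTheory GRing.Theory Num.Theory.
Local Open Scope classical_set_scope.
Local Open Scope ring_scope.

(* Points of R^n are n-tuples (with the product = Borel sigma-algebra). *)

(* Gamma(kappa + m) / Gamma(kappa) written as the rising factorial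
   kappa (kappa+1) ... (kappa+m-1) (no Gamma function in the library). *)
Definition gamma_ratio {R : realType} (kappa : R) (m : nat) : R :=
  \prod_(i < m) (kappa + i%:R).

Definition gegenbauer {R : realType} (kappa : R) (l : nat) (t : R) : R :=
  2 ^+ l * \sum_(j < (l./2).+1)
     ((-1) ^+ j * gamma_ratio kappa (l - j)%N
        / (2 ^+ (2 * j) * (j`!)%:R * ((l - 2 * j)`!)%:R)) * t ^+ (l - 2 * j).

Definition harm_const {R : realType} (n l : nat) : R :=
  Num.sqrt ((((n - 3)`!)%:R * (l`!)%:R * (n + 2 * l - 2)%:R)
            / (((n + l - 3)`!)%:R * (n - 2)%:R)).

Definition p_harm {R : realType} (n l : nat) (k : 'I_n) (x : n.-tuple R) : R :=
  harm_const n l * gegenbauer ((n%:R - 2) / 2) l (tnth x k).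

Definition p_comb {R : realType} (n l : nat) (a x : n.-tuple R) : R :=
  \sum_(i < n) tnth a i * p_harm l i x.

Definition sphere {R : realType} (n : nat) : set (n.-tuple R) :=
  [set x | \sum_(i < n) tnth x i ^+ 2 = 1].
Arguments sphere {R} n.

Definition norm4sq {R : realType} (n : nat) (a : n.-tuple R) : R :=
  Num.sqrt (\sum_(i < n) tnth a i ^+ 4).

Definition rot {R : realType} (n : nat) (Q : 'M[R]_n) (x : n.-tuple R)
  : n.-tuple R := [tuple ((\row_j tnth x j) *m Q) 0 i | i < n].

(* sigma is the uniform probability measure on S^{n-1}: a probability
   measure on R^n concentrated on the sphere and invariant under all
   orthogonal transformations (this characterizes it uniquely). *)
Definition uniform_sphere {R : realType} (n : nat)
  (sigma : probability (n.-tuple R) R) : Prop :=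
  sigma (sphere n) = 1%E /\
  forall Q : 'M[R]_n, Q *m Q^T = 1%:M ->
    forall A : set (n.-tuple R), measurable A ->
      sigma (rot Q @^-1` A) = sigma A.

Definition dTV_gauss {R : realType} (n : nat)
  (sigma : probability (n.-tuple R) R) (f : n.-tuple R -> R) : \bar R :=
  ereal_sup [set `| sigma (f @^-1` A) - normal_prob 0 1 A |%E
            | A in [set A : set R | measurable A]].

(* Main.v *)
Require Import Defs.
From HB Require Import structures.
From mathcomp Require Import all_boot all_order all_algebra.
From mathcomp Require Import all_classical all_reals all_analysis.
From mathcomp Require Import measurable_realfun ring lra zify.
Set Implicit Arguments. Unset Strict Implicit. Unset Printing Implicit Defensive.
Import Order.TTheory GRing.Theory Num.Theory.
Local Open Scope classical_set_scope.
Local Open Scope ring_scope.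

(** Stein's method in its infinitesimal form.  Write [q] for the normalized Gegenbauer polynomial
    [A C_l], [p x = \sum_i a_i q(x_i)] and [lam = l (l + n - 2)].  Differentiating the rotation
    invariance of the uniform measure along the rotation of the plane of [x_i] and [x_j] gives
    [E (x_i d_j F - x_j d_i F) = 0].  With the Gegenbauer differential equation this yields
    [lam E (g(p) p) = E (g'(p) |grad p|^2)] for every C^1 function [g].  For [h] continuous
    with values in [0, 1], the bounded solution [g] of the Stein equation
    [g' w - w g w = h w - E (h Z)] satisfies [|g'| <= 2], hence
    [|E (h(p X)) - E (h Z)| <= 2 E |1 - |grad p|^2 / lam|]; approximating indicators by such [h]
    bounds the total variation distance by the same quantity.
    As [l] is odd, the mean of [(\sum_i a_i x_i q'(x_i))^2] has no mixed terms, so what remains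
    is the fluctuation of [\sum_i a_i^2 q'(x_i)^2 / lam].  Since [E q^2 = 1] its mean is
    [1 + O(1/n)], and since [n x_i^2] and [n x_j^2] are uncorrelated up to [O(1/n)] its variance
    is [O(\sum_i a_i^4 + 1/n)], where [1/n <= \sum_i a_i^4] by the Cauchy-Schwarz inequality. *)

(** * Gegenbauer polynomials *)

(** The constants must not depend on [n], while a coordinate has size about n^(-1/2). The mechanism
    is a power count: [q'^2 / lam] is a sum of terms g n^r t^(2r) with |g| bounded in terms of [l]
    alone, so it is a polynomial in n t^2 with bounded coefficients, and the moments of n x_i^2 stay
    below the Gaussian ones. The hypothesis on the measure offers only mass one on the sphere and
    rotation invariance, hence no density: all moments come from the integration by parts that also
    gives the Stein identity, combined with sum x_i^2 = 1. The normalization E q^2 = 1 is obtained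
    algebraically, from a moment functional whose dimension is a real parameter. Means of absolute
    values are estimated by |Y| <= Y^2 / (2 e) + e / 2 with e = ||a||_4^2, which turns the second
    moment O(e^2) into O(e). The same inequality with e = n^(-1/2) gives the average over [a] from E
    (sum a_i^4) <= 3 / n. *)

Section gegenbauer_polynomials.
Variable R : realType.
Implicit Types (k nu t : R) (l j : nat) (p f : {poly R}).

Definition gegen_coef k l j : R :=
  2 ^+ l * ((-1) ^+ j * gamma_ratio k (l - j)%N
        / (2 ^+ (2 * j) * (j`!)%:R * ((l - 2 * j)`!)%:R)).

Definition gegen_poly k l : {poly R} :=
  \sum_(j < (l./2).+1) gegen_coef k l j *: 'X^(l - 2 * j).

Lemma horner_gegen_poly k l t : (gegen_poly k l).[t] = gegenbauer k l t.
Proof.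
rewrite /gegen_poly /gegenbauer horner_sum mulr_sumr; apply: eq_bigr => j _.
by rewrite hornerZ hornerXn /gegen_coef !mulrA.
Qed.

Lemma gamma_ratioSl k m : gamma_ratio k m.+1 = k * gamma_ratio (k + 1) m.
Proof.
rewrite /gamma_ratio big_ord_recl /= addr0; congr (_ * _).
by apply: eq_bigr => i _; rewrite /bump /= natrD addrA.
Qed.

Lemma gamma_ratioSr k m : gamma_ratio k m.+1 = gamma_ratio k m * (k + m%:R).
Proof. by rewrite /gamma_ratio big_ord_recr. Qed.

Lemma gamma_ratio_gt0 k m : 0 < k -> 0 < gamma_ratio k m.
Proof. by move=> k0; apply: prodr_gt0 => i _; rewrite ltr_pwDl. Qed.

Lemma fact_neq0 n : (n`!)%:R != 0 :> R.
Proof. by rewrite pnatr_eq0 -lt0n fact_gt0. Qed.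

Lemma derivXn_scale m : ('X^m : {poly R})^`() = m%:R *: 'X^(m.-1).
Proof. by rewrite derivXn scaler_nat. Qed.

Lemma gegen_coef_deriv k l j : (2 * j <= l)%N ->
  gegen_coef k l.+1 j * (l.+1 - 2 * j)%:R = 2 * k * gegen_coef (k + 1) l j.
Proof.
move=> jl; rewrite /gegen_coef.
have -> : (l.+1 - j = (l - j).+1)%N by lia.
have -> : (l.+1 - 2 * j = (l - 2 * j).+1)%N by lia.
rewrite gamma_ratioSl factS exprS natrM.
have h1 := fact_neq0 j; have h2 := fact_neq0 (l - 2 * j).
have h3 : (l - 2 * j).+1%:R != 0 :> R by rewrite pnatr_eq0.
move: h1 h2 h3; move: (j`!%:R) ((l - 2 * j)`!%:R) ((l - 2 * j).+1%:R) => a b c h1 h2 h3.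
by field; rewrite h1 h2 h3 expf_neq0 // pnatr_eq0.
Qed.

Lemma deriv_gegen_poly k l :
  (gegen_poly k l.+1)^`() = (2 * k) *: gegen_poly (k + 1) l.
Proof.
pose F j : {poly R} := (gegen_coef k l.+1 j * (l.+1 - 2 * j)%:R) *: 'X^(l - 2 * j).
have -> : (gegen_poly k l.+1)^`() = \sum_(j < l.+1./2.+1) F j.
  rewrite /gegen_poly raddf_sum; apply: eq_bigr => j _ /=.
  rewrite derivZ derivXn_scale /F scalerA.
  by have -> : ((l.+1 - 2 * j).-1 = l - 2 * j)%N by lia.
(* For odd [l] the degree [l.+1] contributes one more term, the constant one, which the derivative
   kills. *)
have -> : \sum_(j < l.+1./2.+1) F j = \sum_(j < l./2.+1) F j.
  case: (boolP (odd l)) => ol.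
    have -> : (l.+1./2 = l./2.+1)%N by lia.
    rewrite big_ord_recr /= {2}/F.
    have -> : (l.+1 - 2 * l./2.+1 = 0)%N by lia.
    by rewrite mulr0 scale0r addr0.
  by have -> : (l.+1./2 = l./2)%N by lia.
rewrite /gegen_poly scaler_sumr; apply: eq_bigr => j _.
rewrite /F scalerA gegen_coef_deriv //.
by have := ltn_ord j; lia.
Qed.

(** This is the differential equation read off at t^m with m = l - 2(j+1): the last two factors on
    the right multiply to l(l + 2k) - m(m + 2k). *)
Lemma gegen_coef_rec k l j : (2 * j.+1 <= l)%N ->
  gegen_coef k l j * (l - 2 * j)%:R * (l - 2 * j).-1%:R =
  - (gegen_coef k l j.+1 * (2 * j.+1)%:R * (2 * l%:R - (2 * j.+1)%:R + 2 * k)).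
Proof.
move=> jl; rewrite /gegen_coef.
have [m lE] : exists m, l = (m + 2 * j.+1)%N by exists (l - 2 * j.+1)%N; rewrite subnK.
have -> : (l - j.+1 = m + j.+1)%N by lia.
have -> : (l - j = (m + j.+1).+1)%N by lia.
have -> : (l - 2 * j = m.+2)%N by lia.
have -> : (l - 2 * j.+1 = m)%N by lia.
have -> : 2 * l%:R - (2 * j.+1)%:R + 2 * k = 2 * (k + (m + j.+1)%:R) :> R.
  rewrite lE !natrD !natrM; move: (m%:R) (j.+1%:R) => a b; ring.
rewrite gamma_ratioSr !factS /= !natrM.
have -> : (2 * j.+1 = (2 * j).+2)%N by lia.
rewrite !exprS.
have h1 := fact_neq0 j; have h2 := fact_neq0 m.
have h3 : m.+1%:R != 0 :> R by rewrite pnatr_eq0.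
have h4 : m.+2%:R != 0 :> R by rewrite pnatr_eq0.
have h5 : j.+1%:R != 0 :> R by rewrite pnatr_eq0.
have h6 : 2 ^+ (2 * j) != 0 :> R by rewrite expf_neq0 // pnatr_eq0.
move: h1 h2 h3 h4 h5 h6.
move: (j`!%:R) (m`!%:R) (m.+1%:R) (m.+2%:R) (j.+1%:R) (2 ^+ (2 * j)) ((-1) ^+ j).
move: (2 ^+ l) (gamma_ratio k (m + j.+1)) ((m + j.+1)%:R).
move=> u v w a b c d e f g *.
by field; do ?[apply/andP; split] => //.
Qed.

Lemma gegen_poly_ode k l :
  (1 - 'X^2) * (gegen_poly k l)^`()^`() - (2 * k + 1) *: ('X * (gegen_poly k l)^`())
  = - (l%:R * (l%:R + 2 * k)) *: gegen_poly k l.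
Proof.
(* [D j] is what the second derivative alone contributes, [E j] what all other terms of the equation
   contribute. [D j] cancels [E j.+1] by [gegen_coef_rec], and the end terms [E 0] and [D l./2]
   vanish. *)
pose D j : {poly R} :=
  (gegen_coef k l j * (l - 2 * j)%:R * (l - 2 * j).-1%:R) *: 'X^(l - 2 * j.+1).
pose E j : {poly R} :=
  (gegen_coef k l j * (2 * j)%:R * (2 * l%:R - (2 * j)%:R + 2 * k)) *: 'X^(l - 2 * j).
apply/eqP; rewrite -subr_eq0 scaleNr opprK; apply/eqP.
transitivity (\sum_(j < l./2.+1) D j + \sum_(j < l./2.+1) E j); last first.
  rewrite big_ord_recr /= [X in _ + X]big_ord_recl /=.
  have -> : E 0%N = 0 by rewrite /E muln0 mulr0 mul0r scale0r.
  have -> : D l./2 = 0.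
    rewrite /D; have : (l - 2 * l./2 = 0)%N \/ (l - 2 * l./2 = 1)%N by lia.
    by case=> ->; rewrite /= !mulr0 ?mul0r scale0r.
  rewrite addr0 add0r -big_split /=; apply: big1 => j _.
  rewrite /D /E /bump /= add1n gegen_coef_rec; last by have := ltn_ord j; lia.
  by rewrite scaleNr addNr.
rewrite /gegen_poly !raddf_sum /= !mulr_sumr !raddf_sum /= -!big_split /=.
apply: eq_bigr => j _.
have jl : (2 * j <= l)%N by have := ltn_ord j; lia.
rewrite !(derivZ, derivXn_scale) !scalerA.
rewrite /D /E; have -> : (l - 2 * j.+1 = (l - 2 * j).-2)%N by lia.
have -> : l%:R = (l - 2 * j)%:R + (2 * j)%:R :> R by rewrite -natrD subnK.
set c := gegen_coef _ _ _; set m := (l - 2 * j)%N; set i := (2 * j)%:R.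
rewrite -!scalerAr mulrBl mul1r -!exprS -!exprD.
case: m => [|[|m]] /=; rewrite ?(mulr0, mul0r, scale0r, scaler0).
- by rewrite subrr !add0r; congr (_ *: _); ring.
- by rewrite !add0r scalerA -scaleNr -scalerDl; congr (_ *: _); ring.
have -> : (2 + m = m.+2)%N by lia.
rewrite scalerBr !scalerA -addrA -addrA; congr (_ + _).
have -> : c * i * (2 * (m.+2%:R + i) - i + 2 * k) =
  - (c * m.+2%:R * m.+1%:R) + (- ((2 * k + 1) * (c * m.+2%:R)) +
     (m.+2%:R + i) * (m.+2%:R + i + 2 * k) * c).
  by rewrite -[m.+2]addn2 -[m.+1]addn1 !natrD; ring.
by rewrite !scalerDl !scaleNr.
Qed.

(* The [r]-th moment of a coordinate of a uniform point of the unit sphere of R^nu. *)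
Definition moment nu (r : nat) : R :=
  if odd r then 0 else \prod_(i < r./2) ((2 * i + 1)%:R / (nu + (2 * i)%:R)).

(** The mean of [p] at one coordinate, as a formal linear functional, so that [nu] can be any real
    number and be shifted freely. [mean_horner] identifies it with a mean over the sphere when [nu]
    is the dimension. *)
Definition momentum nu p : R := \sum_(i < size p) p`_i * moment nu i.

Lemma momentum_bound nu p N : (size p <= N)%N ->
  momentum nu p = \sum_(i < N) p`_i * moment nu i.
Proof.
move=> sN; rewrite /momentum.
rewrite (big_ord_widen _ (fun i => p`_i * moment nu i) sN) big_mkcond /=.
by apply: eq_bigr => i _; case: ltnP => // h; rewrite nth_default // mul0r.
Qed.

Lemma momentumD nu p f : momentum nu (p + f) = momentum nu p + momentum nu f.
Proof.
pose N := maxn (size p) (size f).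
rewrite !(@momentum_bound _ _ N) ?leq_maxl ?leq_maxr ?size_polyD // -big_split /=.
by apply: eq_bigr => i _; rewrite coefD mulrDl.
Qed.

Lemma momentumZ nu (c : R) p : momentum nu (c *: p) = c * momentum nu p.
Proof.
rewrite (@momentum_bound _ (c *: p) (size p)) ?size_scale_leq // mulr_sumr.
by apply: eq_bigr => i _; rewrite coefZ mulrA.
Qed.

Lemma momentum0 nu : momentum nu 0 = 0.
Proof. by rewrite -(scale0r 0) momentumZ mul0r. Qed.

Lemma momentumN nu p : momentum nu (- p) = - momentum nu p.
Proof. by rewrite -scaleN1r momentumZ mulN1r. Qed.

Lemma momentum_sum nu (I : finType) (F : I -> {poly R}) :
  momentum nu (\sum_i F i) = \sum_i momentum nu (F i).
Proof.
by apply: (big_morph (momentum nu)); [exact: momentumD|exact: momentum0].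
Qed.

Lemma momentumXn nu r : momentum nu 'X^r = moment nu r.
Proof.
rewrite (@momentum_bound _ _ r.+1) ?size_polyXn // big_ord_recr /= coefXn eqxx mul1r.
by rewrite big1 ?add0r // => i _; rewrite coefXn ltn_eqF ?mul0r.
Qed.

Lemma moment0 nu : moment nu 0 = 1.
Proof. by rewrite /moment big_ord0. Qed.

Lemma momentSS nu r : 0 < nu ->
  moment nu r.+2 * (nu + r%:R) = r.+1%:R * moment nu r.
Proof.
move=> nu0; rewrite /moment /= negbK; case: ifPn => or; first by rewrite mul0r mulr0.
have rE : r = (2 * r./2)%N by lia.
rewrite big_ord_recr /= addn1 -rE.
have h : nu + r%:R != 0 by rewrite gt_eqF // ltr_pwDl.
by rewrite mulrA mulrVK ?unitfE // mulrC.
Qed.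

(** Integration by parts against the density of a coordinate, proportional to (1 - t^2)^((nu -
    3)/2). On monomials it is the recurrence [momentSS]. *)
Lemma momentum_ibp nu f : 0 < nu ->
  momentum nu ((1 - 'X^2) * f^`()) = (nu - 1) * momentum nu ('X * f).
Proof.
move=> nu0; rewrite -[f]coefK poly_def (raddf_sum (@deriv R)) /=.
rewrite [(1 - _) * _]mulr_sumr ['X * _]mulr_sumr !momentum_sum mulr_sumr.
apply: eq_bigr => i _; rewrite derivZ derivXn_scale -!scalerAr !momentumZ [RHS]mulrCA; congr (_ * _).
rewrite mulrBl mul1r -exprS -exprD momentumD momentumN.
rewrite !momentumXn; case: (i : nat) => [|j] /=; first by rewrite mul0r /moment mulr0.
have := momentSS j nu0; rewrite add2n -natr1 mulrDl => h; lra.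
Qed.

(** Multiplying the coordinate density by 1 - t^2 gives, up to a constant, the density in dimension
    nu + 2; the constant is the mean of 1 - t^2, that is 1 - 1/nu. *)
Lemma momentum_shift nu f : 0 < nu ->
  momentum nu ((1 - 'X^2) * f) = (nu - 1) / nu * momentum (nu + 2) f.
Proof.
move=> nu0; rewrite -[f]coefK poly_def [(1 - _) * _]mulr_sumr !momentum_sum mulr_sumr.
apply: eq_bigr => i _; rewrite -!scalerAr !momentumZ mulrCA; congr (_ * _).
rewrite mulrBl mul1r -exprD momentumD momentumN !momentumXn add2n.
rewrite /moment /= negbK; case: ifPn => oi; first by rewrite subr0 mulr0.
rewrite -[X in X - _]mulr1 big_ord_recr /= -mulrBr.
have -> : \prod_(j < i./2) ((2 * j + 1)%:R / (nu + (2 * j)%:R)) =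
  \prod_(j < i./2) ((2 * j + 1)%:R / (nu + 2 + (2 * j)%:R)) * ((nu + (2 * i./2)%:R) / nu).
  elim: (i./2) => [|m IH]; first by rewrite !big_ord0 muln0 addr0 mul1r divff // gt_eqF.
  rewrite !big_ord_recr /= IH.
  have h1 : nu + (2 * m)%:R != 0 by rewrite gt_eqF // ltr_pwDl.
  have h2 : nu + 2 + (2 * m)%:R != 0 by rewrite gt_eqF // ltr_pwDl // addr_gt0.
  have -> : nu + (2 * m.+1)%:R = nu + 2 + (2 * m)%:R by rewrite mulnS natrD addrA.
  move: h1 h2; move: ((2 * m)%:R) ((2 * m + 1)%:R) (\prod_(_ < m) _) => a b c *.
  by field; do ?[apply/andP; split] => //; rewrite gt_eqF.
have h1 : nu + (2 * i./2)%:R != 0 by rewrite gt_eqF // ltr_pwDl.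
rewrite natrD; move: h1; move: ((2 * i./2)%:R) (\prod_(_ < _) _) => a b h1.
by field; rewrite h1 gt_eqF.
Qed.

(** Green's formula for an eigenfunction: integrate p p' by parts and replace p'' by means of the
    equation. *)
Lemma momentum_ode nu (lam : R) p : 0 < nu ->
  (1 - 'X^2) * p^`()^`() - (nu - 1) *: ('X * p^`()) = - lam *: p ->
  momentum nu ((1 - 'X^2) * p^`() ^+ 2) = lam * momentum nu (p ^+ 2).
Proof.
move=> nu0 ode.
have := momentum_ibp (p * p^`()) nu0.
rewrite derivM mulrDr momentumD -expr2.
have := congr1 (fun f => momentum nu (f * p)) ode.
rewrite /= mulrBl momentumD momentumN -!scalerAl !momentumZ -expr2.
have -> : (1 - 'X^2) * p^`()^`() * p = (1 - 'X^2) * (p * p^`()^`()).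
  by rewrite -mulrA [p * _]mulrC.
have -> : 'X * p^`() * p = 'X * (p * p^`()) by rewrite -mulrA [p * _]mulrC.
by move=> H1 H2; lra.
Qed.

(* Moving one derivative by parts and using [C_l^k' = 2 k C_(l-1)^(k+1)] lowers the degree by
   one and raises the dimension by two. *)
Lemma momentum_gegen_sqr k l : 0 < k ->
  momentum (2 * k + 2) (gegen_poly k l ^+ 2) =
  \prod_(i < l) (2 * k + i%:R) * k / ((l`!)%:R * (k + l%:R)).
Proof.
elim: l k => [|l IH] k k0.
  have -> : gegen_poly k 0 = 1.
    rewrite /gegen_poly big_ord1 /gegen_coef /gamma_ratio /= muln0 subnn big_ord0.
    by rewrite fact0 !expr0 !mul1r invr1 scale1r.
  by rewrite expr1n -(expr0 'X) momentumXn moment0 big_ord0 fact0 !mul1r addr0 divff // gt_eqF.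
set C := gegen_poly k l.+1; set nu := 2 * k + 2.
have nu0 : 0 < nu by rewrite /nu; lra.
have lam : l.+1%:R * (l.+1%:R + 2 * k) != 0 :> R.
  by rewrite mulf_neq0 ?pnatr_eq0 // gt_eqF // addr_gt0 // mulr_gt0.
have E1 : momentum nu ((1 - 'X^2) * C^`() ^+ 2) =
          l.+1%:R * (l.+1%:R + 2 * k) * momentum nu (C ^+ 2).
  apply: momentum_ode => //; rewrite -gegen_poly_ode.
  by have -> : nu - 1 = 2 * k + 1 by rewrite /nu; ring.
have E2 : C^`() ^+ 2 = (4 * k ^+ 2) *: gegen_poly (k + 1) l ^+ 2.
  by rewrite /C deriv_gegen_poly exprZn; congr (_ *: _); ring.
apply: (mulfI lam); rewrite -E1 E2 -scalerAr momentumZ momentum_shift //.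
have -> : nu + 2 = 2 * (k + 1) + 2 by rewrite /nu; ring.
rewrite IH; last by rewrite addr_gt0.
(* Both sides are the product of 2k + i over i < l + 2. *)
have P1 : \prod_(i < l) (2 * (k + 1) + i%:R) * (2 * k * (2 * k + 1)) =
  \prod_(i < l.+1) (2 * k + i%:R) * (2 * k + l.+1%:R).
  elim: l {IH C lam E1 E2} => [|l IH].
    by rewrite big_ord0 big_ord_recl big_ord0 /=; ring.
  rewrite big_ord_recr [in RHS]big_ord_recr /= mulrAC IH -!mulrA; congr (_ * _).
  by congr (_ * _); rewrite -[l.+2]addn2 natrD; ring.
rewrite factS natrM.
have h1 : k + l.+1%:R != 0 by rewrite gt_eqF // addr_gt0.
have h2 := fact_neq0 l.
have h3 : l.+1%:R != 0 :> R by rewrite pnatr_eq0.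
have h4 : l.+1%:R + 2 * k != 0 by rewrite gt_eqF // addr_gt0 // mulr_gt0.
have -> : k + 1 + l%:R = k + l.+1%:R by rewrite -natr1; ring.
have h5 : nu != 0 by rewrite gt_eqF.
have h6 : k + 1 != 0 by rewrite gt_eqF // addr_gt0.
have -> : \prod_(i < l.+1) (2 * k + i%:R) =
   \prod_(i < l) (2 * (k + 1) + i%:R) * (2 * k * (2 * k + 1)) / (l.+1%:R + 2 * k).
  by rewrite P1 [2 * k + _]addrC mulfK.
move: h1 h2 h3 h4 h5 h6; rewrite /nu.
move: (l.+1%:R) (l`!%:R) (\prod_(_ < _) _) => a b c h1 h2 h3 h4 h5 h6.
by field; do ?[apply/andP; split] => //.
Qed.

End gegenbauer_polynomials.

(** * Normalization, and coefficient bounds uniform in the dimension *)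

Section normalized_gegenbauer.
Variable R : realType.
Implicit Types (n l j : nat).

Definition harm_poly n l : {poly R} := harm_const n l *: gegen_poly ((n%:R - 2) / 2) l.

Definition harm_eigenvalue n l : R := l%:R * (l%:R + n%:R - 2).

Lemma p_harm_horner n l (i : 'I_n) (x : n.-tuple R) :
  p_harm l i x = (harm_poly n l).[tnth x i].
Proof. by rewrite /p_harm /harm_poly hornerZ horner_gegen_poly. Qed.

Lemma harm_poly_ode n l :
  (1 - 'X^2) * (harm_poly n l)^`()^`() - (n%:R - 1) *: ('X * (harm_poly n l)^`())
  = - harm_eigenvalue n l *: harm_poly n l.
Proof.
rewrite /harm_poly !derivZ -!scalerAr scalerA [_ * harm_const _ _]mulrC -scalerA -scalerBr.
have := gegen_poly_ode ((n%:R - 2) / 2 : R) l.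
have -> : 2 * ((n%:R - 2) / 2) + 1 = n%:R - 1 :> R by field.
have -> : l%:R * (l%:R + 2 * ((n%:R - 2) / 2)) = harm_eigenvalue n l.
  by rewrite /harm_eigenvalue; field.
by move=> ->; rewrite !scalerA mulrC.
Qed.

(** The quotient (n + l - 3)! / (n - 3)! becomes the rising factorial of n - 2, the form in which
    [momentum_gegen_sqr] delivers the norm. *)
Lemma harm_const_sqr n l : (3 <= n)%N ->
  harm_const n l ^+ 2 = (l`!)%:R * (n + 2 * l - 2)%:R /
    (\prod_(i < l) (n%:R - 2 + i%:R) * (n%:R - 2)) :> R.
Proof.
move=> n3; have [m ->] : exists m, n = m.+3 by exists (n - 3)%N; lia.
rewrite /harm_const sqr_sqrtr; last by rewrite divr_ge0.
have -> : (m.+3 - 3 = m)%N by lia.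
have -> : (m.+3 + l - 3 = m + l)%N by lia.
have -> : (m.+3 - 2 = m.+1)%N by lia.
have -> : m.+3%:R - 2 = m.+1%:R :> R by rewrite -[m.+3]addn2 natrD addrK.
have -> : ((m + l)`!)%:R = (m`!)%:R * \prod_(i < l) (m.+1%:R + i%:R) :> R.
  elim: l => [|l IH]; first by rewrite addn0 big_ord0 mulr1.
  by rewrite addnS factS natrM IH big_ord_recr /= mulrC -mulrA -natrD addSn.
have h1 := fact_neq0 R m.
have h2 : m.+1%:R != 0 :> R by rewrite pnatr_eq0.
have h3 : \prod_(i < l) (m.+1%:R + i%:R) != 0 :> R.
  by rewrite gt_eqF // prodr_gt0 // => i _; rewrite ltr_pwDl.
move: h1 h2 h3; move: (m`!%:R) (m.+1%:R : R) (\prod_(_ < _) _) => a b c *.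
by field; do ?[apply/andP; split] => //.
Qed.

(** With k = (n - 2)/2 one has 2k + 2 = n, so [momentum_gegen_sqr] applies, and A^2 is exactly the
    inverse of its value. *)
Lemma momentum_harm_sqr n l : (3 <= n)%N -> momentum n%:R (harm_poly n l ^+ 2) = 1.
Proof.
move=> n3; have n3R : 3 <= n%:R :> R by rewrite ler_nat.
rewrite /harm_poly exprZn momentumZ.
rewrite [X in momentum X](_ : _ = 2 * ((n%:R - 2) / 2) + 2); last by field.
rewrite momentum_gegen_sqr; last by lra.
rewrite harm_const_sqr //.
have -> : \prod_(i < l) (2 * ((n%:R - 2) / 2) + i%:R) = \prod_(i < l) (n%:R - 2 + i%:R) :> R.
  by apply: eq_bigr => i _; congr (_ + _); field.
have -> : (n%:R - 2) / 2 + l%:R = (n + 2 * l - 2)%:R / 2 :> R.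
  by rewrite natrB ?natrD ?natrM; [field|lia].
have h1 := fact_neq0 R l.
have h2 : (n + 2 * l - 2)%:R != 0 :> R by rewrite pnatr_eq0; lia.
have h3 : \prod_(i < l) (n%:R - 2 + i%:R) != 0 :> R.
  by rewrite gt_eqF // prodr_gt0 // => i _; rewrite ltr_pwDl //; lra.
have h4 : n%:R - 2 != 0 :> R by rewrite gt_eqF //; lra.
move: h1 h2 h3 h4; move: (l`!%:R : R) ((n + 2 * l - 2)%:R : R) (\prod_(_ < _) _) => a b c *.
by field; do ?[apply/andP; split] => //.
Qed.

Lemma harm_eigenvalue_gt0 n l : (3 <= n)%N -> odd l -> 0 < harm_eigenvalue n l.
Proof.
move=> n3 ol; have n3R : 3 <= n%:R :> R by rewrite ler_nat.
have l1 : 1 <= l%:R :> R by rewrite ler1n; lia.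
by rewrite /harm_eigenvalue mulr_gt0 //; lra.
Qed.

Lemma momentum_deriv_harm_sqr n l : (3 <= n)%N ->
  momentum n%:R ((1 - 'X^2) * (harm_poly n l)^`() ^+ 2) = harm_eigenvalue n l.
Proof.
move=> n3; have n0 : 0 < n%:R :> R by rewrite ltr0n; lia.
by rewrite (momentum_ode n0 (harm_poly_ode n l)) momentum_harm_sqr // mulr1.
Qed.

(** The only dependence on [n] is a rising factorial with l - j factors, each at most (l + 1) n; the
    denominator is at least 1. *)
Lemma gegen_coef_bound n l j : (3 <= n)%N ->
  `|gegen_coef ((n%:R - 2) / 2) l j| <= 2 ^+ l * (l.+1)%:R ^+ l * n%:R ^+ (l - j) :> R.
Proof.
move=> n3; have n3R : 3 <= n%:R :> R by rewrite ler_nat.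
have k0 : 0 < (n%:R - 2) / 2 :> R by lra.
rewrite /gegen_coef !normrM !normrX normrN1 expr1n mul1r normfV (ger0_norm (_ : 0 <= 2)) //.
rewrite -[X in _ <= X]mulrA ler_wpM2l ?exprn_ge0 //.
rewrite ger0_norm ?(ltW (gamma_ratio_gt0 _ _)) // ger0_norm ?mulr_ge0 ?exprn_ge0 //.
apply: (@le_trans _ _ (gamma_ratio ((n%:R - 2) / 2) (l - j))).
  rewrite ler_piMr ?(ltW (gamma_ratio_gt0 _ _)) // invf_le1 ?mulr_gt0 ?exprn_gt0 ?ltr0n ?fact_gt0 //.
  by rewrite -natrX -!natrM ler1n !muln_gt0 expn_gt0 !fact_gt0.
apply: (@le_trans _ _ ((l.+1%:R * n%:R) ^+ (l - j))).
  rewrite /gamma_ratio -[X in _ <= _ ^+ X]card_ord -prodr_const.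
  apply: ler_prod => i _; apply/andP; split; first by rewrite addr_ge0 // ltW.
  have : i%:R <= l%:R :> R by rewrite ler_nat; have := ltn_ord i; lia.
  have : l%:R <= l%:R * n%:R :> R by rewrite ler_peMr // ler1n; lia.
  have -> : l.+1%:R * n%:R = l%:R * n%:R + n%:R :> R by rewrite -[l.+1]addn1 natrD mulrDl mul1r.
  by lra.
rewrite exprMn ler_wpM2r ?exprn_ge0 // ler_weXn2l ?ler1n //; lia.
Qed.

(** A^2 = O(n^(-l)): for n >= 3 each factor satisfies n <= 3 (n - 2 + i), and n + 2l - 2 <= (2l +
    1)(n - 2). *)
Lemma harm_const_sqr_bound n l : (3 <= n)%N ->
  harm_const n l ^+ 2 * n%:R ^+ l <= (l`!)%:R * (2 * l + 1)%:R * 3 ^+ l :> R.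
Proof.
move=> n3; have n3R : 3 <= n%:R :> R by rewrite ler_nat.
rewrite harm_const_sqr //.
have h3 : 0 < \prod_(i < l) (n%:R - 2 + i%:R) :> R.
  by rewrite prodr_gt0 // => i _; rewrite ltr_pwDl //; lra.
have h4 : 0 < n%:R - 2 :> R by lra.
have E1 : (n + 2 * l - 2)%:R <= (2 * l + 1)%:R * (n%:R - 2) :> R.
  rewrite natrB ?natrD ?natrM; last by lia.
  have : 0 <= l%:R :> R by []. by nra.
have E2 : n%:R ^+ l <= 3 ^+ l * \prod_(i < l) (n%:R - 2 + i%:R) :> R.
  rewrite -[X in _ ^+ X <= _]card_ord -[X in _ <= _ ^+ X * _]card_ord -!prodr_const -big_split /=.
  apply: ler_prod => i _; rewrite ler0n /=.
  have : 0 <= i%:R :> R by []. by lra.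
rewrite mulrAC ler_pdivrMr ?mulr_gt0 //.
have -> : l`!%:R * (2 * l + 1)%:R * 3 ^+ l * (\prod_(i < l) (n%:R - 2 + i%:R) * (n%:R - 2)) =
  l`!%:R * (((2 * l + 1)%:R * (n%:R - 2)) * (3 ^+ l * \prod_(i < l) (n%:R - 2 + i%:R))) :> R.
  by ring.
by rewrite -[X in X <= _]mulrA ler_wpM2l // ler_pM // exprn_ge0.
Qed.

(** Power count: A^2 is O(n^(-l)), 1/lam is O(1/n), and the coefficients with indices j and k are
    O(n^(l-j)) and O(n^(l-k)). The product is O(n^(l-1-j-k)), whose exponent is half the degree of
    the monomial it multiplies. Thus each term is a bounded multiple of a power of n t^2. *)
Lemma deriv_harm_sqr_expansion l : odd l ->
  exists2 K : R, 0 <= K & forall n, (3 <= n)%N ->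
  exists2 g : 'I_l./2.+1 * 'I_l./2.+1 -> R, (forall t, `|g t| <= K) &
  (harm_eigenvalue n l)^-1 *: (harm_poly n l)^`() ^+ 2 =
  \sum_t (g t * n%:R ^+ (l - 1 - t.1 - t.2)) *: 'X^(2 * (l - 1 - t.1 - t.2)).
Proof.
move=> ol.
exists (l`!%:R * (2 * l + 1)%:R * 3 ^+ l * 2 * (2 ^+ l * (l.+1)%:R ^+ l * l%:R) ^+ 2).
  by rewrite !mulr_ge0 ?exprn_ge0 ?mulr_ge0 ?exprn_ge0.
move=> n n3; have n3R : 3 <= n%:R :> R by rewrite ler_nat.
have n0 : 0 < n%:R :> R by lra.
pose c j : R := gegen_coef ((n%:R - 2) / 2) l j * (l - 2 * j)%:R.
pose g (t : 'I_l./2.+1 * 'I_l./2.+1) : R :=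
  (harm_eigenvalue n l)^-1 * harm_const n l ^+ 2 * c t.1 * c t.2 / n%:R ^+ (l - 1 - t.1 - t.2).
exists g; last first.
  have -> : (harm_poly n l)^`() =
      harm_const n l *: \sum_(j < l./2.+1) c j *: 'X^(l - 2 * j - 1).
    rewrite /harm_poly derivZ /gegen_poly (raddf_sum (@deriv R)) /=; congr (_ *: _).
    apply: eq_bigr => j _; by rewrite derivZ derivXn_scale subn1 scalerA.
  rewrite exprZn [(\sum_(j < _) _) ^+ 2]expr2 big_distrlr /= pair_bigA /= !scaler_sumr.
  apply: eq_bigr => -[j k] _; rewrite /= -scalerAl -scalerAr !scalerA -exprD.
  (* No subtraction is truncated: as [l] is odd, 2j and 2k are at most l - 1. *)
  have -> : (l - 2 * j - 1 + (l - 2 * k - 1) = 2 * (l - 1 - j - k))%N.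
    by have := ltn_ord j; have := ltn_ord k; lia.
  by congr (_ *: _); rewrite /g /= divfK ?expf_neq0 ?gt_eqF // !mulrA.
have cb j : `|c j| <= 2 ^+ l * (l.+1)%:R ^+ l * l%:R * n%:R ^+ (l - j).
  by rewrite /c normrM [leRHS]mulrAC [`|_%:R|]ger0_norm // ler_pM ?gegen_coef_bound // ler_nat; lia.
move=> [j k]; rewrite /g /= normrM normfV (ger0_norm (exprn_ge0 _ (ltW n0))).
have l0 := harm_eigenvalue_gt0 n3 ol.
have h : 0 <= (harm_eigenvalue n l)^-1 * harm_const n l ^+ 2.
  by rewrite mulr_ge0 ?sqr_ge0 // invr_ge0 ltW.
rewrite ler_pdivrMr ?exprn_gt0 // normrM normrM (ger0_norm h).
(* Since l >= 1, lam >= n - 1 >= n / 2. *)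
have El : (harm_eigenvalue n l)^-1 * n%:R <= 2.
  rewrite ler_pdivrMl // /harm_eigenvalue.
  have : 1 <= l%:R :> R by rewrite ler1n; lia.
  by nra.
have nl j' k' : (j' < l./2.+1)%N -> (k' < l./2.+1)%N ->
    n%:R ^+ (l - j') * n%:R ^+ (l - k') =
    n%:R ^+ l * n%:R * n%:R ^+ (l - 1 - j' - k') :> R.
  by move=> hj hk; rewrite -exprD -exprSr -exprD; congr (_ ^+ _); lia.
set B := 2 ^+ l * l.+1%:R ^+ l * l%:R in cb *.
have B0 : 0 <= B by rewrite !mulr_ge0 ?exprn_ge0.
apply: (@le_trans _ _ ((harm_eigenvalue n l)^-1 * harm_const n l ^+ 2 *
    (B * n%:R ^+ (l - j)) * (B * n%:R ^+ (l - k)))).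
  by apply: ler_pM => //; [exact: mulr_ge0|exact: ler_wpM2l].
have -> : (harm_eigenvalue n l)^-1 * harm_const n l ^+ 2 *
    (B * n%:R ^+ (l - j)) * (B * n%:R ^+ (l - k)) =
  (harm_eigenvalue n l)^-1 * harm_const n l ^+ 2 * B ^+ 2 *
    (n%:R ^+ (l - j) * n%:R ^+ (l - k)) by ring.
rewrite nl // [leLHS]mulrA; apply: ler_wpM2r; first by rewrite exprn_ge0 // ltW.
have -> : (harm_eigenvalue n l)^-1 * harm_const n l ^+ 2 * B ^+ 2 * (n%:R ^+ l * n%:R) =
  (harm_const n l ^+ 2 * n%:R ^+ l) * ((harm_eigenvalue n l)^-1 * n%:R) * B ^+ 2 by ring.
apply: ler_wpM2r; first exact: sqr_ge0.
apply: ler_pM => //; last exact: harm_const_sqr_bound.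
  by rewrite mulr_ge0 ?sqr_ge0 // exprn_ge0 // ltW.
by rewrite mulr_ge0 // invr_ge0 ltW.
Qed.

End normalized_gegenbauer.

Import numFieldNormedType.Exports.

(** * Derivatives of real functions at a point *)

Section pointwise_derivatives.
Context {R : realType}.
Implicit Types (f g : R -> R) (x a b : R).

Lemma is_derive1D f g x a b : is_derive x 1 f a -> is_derive x 1 g b ->
  is_derive x 1 (fun y => f y + g y) (a + b).
Proof. exact: is_deriveD. Qed.

Lemma is_derive1M f g x a b : is_derive x 1 f a -> is_derive x 1 g b ->
  is_derive x 1 (fun y => f y * g y) (f x * b + g x * a).
Proof. exact: is_deriveM. Qed.

Lemma is_derive1Z f x a b : is_derive x 1 f a -> is_derive x 1 (fun y => b * f y) (b * a).
Proof. exact: is_deriveZ. Qed.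

Lemma is_derive1_chain f g x a b : is_derive (g x) 1 f a -> is_derive x 1 g b ->
  is_derive x 1 (fun y => f (g y)) (a * b).
Proof. exact: is_derive1_comp. Qed.

Lemma is_derive1_sum n (F : 'I_n -> R -> R) x (a : 'I_n -> R) :
  (forall i, is_derive x 1 (F i) (a i)) ->
  is_derive x 1 (fun y => \sum_i F i y) (\sum_i a i).
Proof.
move=> H; have := is_derive_sum H; congr (is_derive _ _ _ _).
by apply/funext => y; rewrite fct_sumE.
Qed.

Lemma is_derive1_continuous f x a : is_derive x 1 f a -> {for x, continuous f}.
Proof. by move=> H; apply: differentiable_continuous; apply/derivable1_diffP; exact: ex_derive. Qed.

End pointwise_derivatives.

(** * Testing Borel measures with continuous functions *)

Section continuous_approximation.
Context {R : realType}.
Implicit Types (mu nu : probability R R) (h : R -> R).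

Definition unit_continuous h := continuous h /\ forall t, 0 <= h t <= 1.

Lemma integrable_bounded (d : measure_display) (T : measurableType d)
    (mu : probability T R) (f : T -> R) (M : R) :
  measurable_fun setT f -> (forall t, `|f t| <= M) ->
  mu.-integrable setT (EFin \o f).
Proof.
move=> mf fM; apply: measurable_bounded_integrable => //.
  exact: le_lt_trans (probability_le1 mu measurableT) (ltry _).
by exists M; split; [exact: num_real|move=> x Mx t _; exact: le_trans (fM t) (ltW Mx)].
Qed.

(* The two laws compared in total variation have to be approximated by the same function,
   hence the pair [m]. *)
Definition approximable (m : bool -> probability R R) (A : set R) := measurable A /\
  forall e : R, 0 < e -> exists2 h, unit_continuous h &
    forall b, \int[m b]_t `|h t - \1_A t| <= e.

Lemma near_bool (P : bool -> nat -> Prop) :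
  (forall b, \forall n \near \oo, P b n) -> exists n, forall b, P b n.
Proof.
move=> H; have [n _ /(_ n (leqnn n)) [Ht Hf]] := filterI (H true) (H false).
by exists n => -[].
Qed.

Lemma measurable_distance h (A : set R) : unit_continuous h -> measurable A ->
  measurable_fun setT (fun t => `|h t - \1_A t|).
Proof.
move=> [ch _] mA; apply: measurableT_comp => //; apply: measurable_funB => //.
exact: continuous_measurable_fun.
Qed.

Lemma distance_le1 h (A : set R) t : unit_continuous h -> `|h t - \1_A t| <= 1.
Proof.
move=> [_ /(_ t) /andP[h0 h1]]; rewrite indicE.
by case: (t \in A) => /=; rewrite ler_norml; lra.
Qed.

Lemma integrable_distance mu h (A : set R) : unit_continuous h -> measurable A ->
  mu.-integrable setT (EFin \o (fun t => `|h t - \1_A t|)).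
Proof.
move=> uh mA; apply: (@integrable_bounded _ _ _ _ 1); first exact: measurable_distance.
by move=> t; rewrite normr_id distance_le1.
Qed.

Lemma approximableC m A : approximable m A -> approximable m (~` A).
Proof.
move=> [mA aA]; split; first exact: measurableC.
move=> e /aA[h [ch h01] he]; exists (fun t => 1 - h t).
  split; last by move=> t; have := h01 t; lra.
  by move=> t; apply: cvgB; [exact: cvg_cst|exact: ch].
move=> b; apply: le_trans (he b); rewrite le_eqVlt; apply/orP; left; apply/eqP.
apply: eq_Rintegral => t _; rewrite !indicE in_setC -normrN; congr (`|_|).
by case: (t \in A) => /=; lra.
Qed.

(** The maximum of two approximants works: its distance to the indicator of the union is at most the
    sum of the two distances. *)
Lemma approximableU m A B :
  approximable m A -> approximable m B -> approximable m (A `|` B).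
Proof.
move=> [mA aA] [mB aB]; split; first exact: measurableU.
move=> e e0; have e20 : 0 < e / 2 by rewrite divr_gt0.
have [h uh he] := aA _ e20; have [g ug ge] := aB _ e20.
have uhg : unit_continuous (fun t => Num.max (h t) (g t)).
  split; first by move=> t; apply: continuous_max; [exact: uh.1|exact: ug.1].
  by move=> t; have := uh.2 t; have := ug.2 t; rewrite /Num.max; case: ifP; lra.
exists (fun t => Num.max (h t) (g t)) => //.
move=> b; rewrite (splitr e); apply: le_trans (lerD (he b) (ge b)).
rewrite -RintegralD //; [|exact: integrable_distance..].
apply: le_Rintegral => //.
- by apply: integrable_distance => //; exact: measurableU.
- apply: (@integrable_bounded _ _ _ _ 2).
    by apply: measurable_funD; exact: measurable_distance.
  move=> t; rewrite ger0_norm ?addr_ge0 //.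
  by have := distance_le1 A t uh; have := distance_le1 B t ug; lra.
- move=> t _; have := uh.2 t; have := ug.2 t; rewrite !indicE in_setU.
  rewrite /Num.max; case: ifPn; rewrite -?leNgt;
  case: (t \in A); case: (t \in B) => /= H1 H2 H3; 
  do ? (case: ger0P => ?); lra.
Qed.

Lemma approximable_set0 m : approximable m set0.
Proof.
split => // e e0; exists (cst 0).
  split; first by move=> t; exact: cvg_cst.
  by move=> t; rewrite lexx ler01.
move=> b; under eq_Rintegral do rewrite indic0 subrr normr0.
by rewrite Rintegral_cst // mul0r ltW.
Qed.

(** By continuity from below, a finite union [B n] misses at most e/2 of the mass of the whole union
    under both laws; the approximant of [B n] costs another e/2. *)
Lemma approximable_bigcup m (F : (set R)^nat) :
  (forall k, approximable m (F k)) -> approximable m (\bigcup_k F k).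
Proof.
move=> aF; have mF k : measurable (F k) by case: (aF k).
have mUF : measurable (\bigcup_k F k) by exact: bigcupT_measurable.
split => // e e0.
pose B n := \big[setU/set0]_(k < n) F k.
have aB n : approximable m (B n).
  rewrite /B; elim: n => [|n IH]; first by rewrite big_ord0; exact: approximable_set0.
  by rewrite big_ord_recr /=; exact: approximableU.
have mB n : measurable (B n) by case: (aB n).
have BU n : B n `<=` \bigcup_k F k.
  by rewrite /B -bigcup_mkord; apply: bigcup_sub => k _; exact: bigcup_sup.
have cB b : m b (B n) @[n --> \oo] --> m b (\bigcup_k F k).
  have -> : \bigcup_k F k = \bigcup_n B n.
    apply/seteqP; split => x [k _ Fx].
      by exists k.+1 => //; rewrite /B big_ord_recr /=; right.
    exact: BU Fx.
  apply: nondecreasing_cvg_mu => //; first exact: bigcupT_measurable.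
  move=> i j ij; apply/subsetPset; rewrite /B -!bigcup_mkord.
  by apply: bigcup_subset => k /= ki; exact: leq_trans ki ij.
have e20 : 0 < e / 2 by rewrite divr_gt0.
have [n Hn] : exists n, forall b, fine (m b (\bigcup_k F k)) - fine (m b (B n)) <= e / 2.
  apply: near_bool => b.
  have /cvgrPdist_le /(_ _ e20) :
      fine (m b (B n)) @[n --> \oo] --> fine (m b (\bigcup_k F k)).
    by apply: fine_cvg; rewrite fineK // fin_num_measure.
  by apply: filterS => n; apply: le_trans; exact: ler_norm.
have [h uh he] := (aB n).2 _ e20.
exists h => // b; rewrite (splitr e); set mu := m b.
have ind (A : set R) : measurable A -> mu.-integrable setT (EFin \o (\1_A : R -> R)).
  move=> mA; apply: (@integrable_bounded _ _ _ _ 1) => // t.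
  by rewrite indicE; case: (_ \in _); rewrite ?normr1 ?normr0.
have intind (A : set R) : measurable A -> \int[mu]_t \1_A t = fine (mu A).
  by move=> mA; rewrite /Rintegral integral_indic // setIT.
apply: le_trans (lerD (he b) (Hn b)).
have -> : fine (mu (\bigcup_k F k)) - fine (mu (B n)) =
    \int[mu]_t (\1_(\bigcup_k F k) t - \1_(B n) t).
  by rewrite RintegralB //; [rewrite !intind|exact: ind..].
rewrite -RintegralD //; [|exact: integrable_distance|]; last first.
  apply: (@integrable_bounded _ _ _ _ 1).
    by apply: measurable_funB.
  by move=> t; rewrite !indicE; case: (_ \in _); case: (_ \in _) => /=; rewrite ler_norml; lra.
apply: le_Rintegral => //; first exact: integrable_distance.
  apply: (@integrable_bounded _ _ _ _ 2).
    by apply: measurable_funD; [exact: measurable_distance|exact: measurable_funB].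
  move=> t; apply: le_trans (ler_normD _ _) _; have := distance_le1 (B n) t uh.
  rewrite normr_id !indicE; case: (_ \in _); case: (_ \in _) => /=;
    do ? (case: ger0P => ?); lra.
move=> t _; rewrite !indicE.
have [tB|tB] := boolP (t \in B n).
  have -> : (t \in \bigcup_k F k) = true by apply: mem_set; apply: BU; exact: set_mem tB.
  by rewrite /= subrr addr0.
by have := uh.2 t; case: (_ \in _) => /=; do ? (case: ger0P => ?); lra.
Qed.

(** Ramps of slope n + 1 starting at [x] vanish at [x] itself and thus converge everywhere to the
    indicator of the open ray; dominated convergence turns this into convergence in mean. *)
Lemma approximable_ray m x : approximable m `]x, +oo[%classic.
Proof.
split => // e e0.
pose h (n : nat) t := Num.min (Num.max (n.+1%:R * (t - x)) 0) 1 : R.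
have uh n : unit_continuous (h n).
  split.
    move=> t; apply: (@continuous_min _ _ (fun t => Num.max (n.+1%:R * (t - x)) 0) (cst 1));
      last exact: cvg_cst.
    apply: (@continuous_max _ _ (fun t => n.+1%:R * (t - x)) (cst 0)); last exact: cvg_cst.
    by apply: cvgMl_tmp; apply: cvgB; [exact: cvg_id|exact: cvg_cst].
  by move=> t; rewrite /h le_min le_max lexx orbT ler01 ge_min lexx orbT.
pose D := `]x, +oo[%classic.
have mD : measurable D by exact: measurable_itv.
have mh n : measurable_fun setT (EFin \o h n).
  by apply/measurable_EFinP; exact: continuous_measurable_fun (uh n).1.
have mi : measurable_fun setT (EFin \o (\1_D : R -> R)).
  by apply/measurable_EFinP; exact: measurable_indic.
have H1 b : {ae m b, forall t, [set: R] t -> (EFin \o h n) t @[n --> \oo] --> (EFin \o \1_D) t}.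
  apply: aeW => t _; apply: cvg_EFin; first by near=> n.
  rewrite indicE; have [|] := boolP (t \in D).
    rewrite inE /D /= in_itv /= andbT => xt.
    apply: cvg_near_cst; near=> n; rewrite /h.
    have : 1 <= n.+1%:R * (t - x).
      rewrite -ler_pdivrMr ?subr_gt0 // div1r; near: n; exists (Num.bound (t - x)^-1) => //= i.
      move=> H; apply: le_trans (ltW (archi_boundP _)) _; first by rewrite invr_ge0 subr_ge0 ltW.
      by rewrite ler_nat (leq_trans H).
    move=> H /=; rewrite max_l ?(le_trans _ H) // min_r //.
  rewrite notin_setE /D /= in_itv /= andbT => /negP; rewrite -leNgt => tx.
  apply: cvg_near_cst; near=> n; rewrite /= /h max_r ?min_l // mulr_ge0_le0 // subr_le0 //.
have H2 b : (m b).-integrable setT (cst 1%E).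
  by apply: (@integrable_bounded _ _ (m b) (cst 1) 1) => // t; rewrite normr1.
have H3 b : {ae m b, forall t n, [set: R] t -> (`|(EFin \o h n) t| <= cst 1 t)%E}.
  apply: aeW => t n _ /=; rewrite lee_fin; have := (uh n).2 t.
  by rewrite ler_norml; lra.
have [n Hn] : exists n, forall b, \int[m b]_t `|h n t - \1_D t| <= e.
  apply: near_bool => b.
  have [_ H _] := dominated_convergence measurableT mh mi (H1 b) (H2 b) (H3 b).
  have /fine_cvgP[_ /cvgrPdist_le /(_ _ e0)] := H.
  by apply: filterS => n; apply: le_trans; rewrite sub0r normrN; exact: ler_norm.
by exists (h n).
Unshelve. all: by end_near. Qed.

(* [approximable m] is a sigma-algebra that contains the open rays. *)
Lemma measurable_approximable m (A : set R) : measurable A -> approximable m A.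
Proof.
move=> mA.
have : <<s RGenOInfty.G (R := R)>> A by rewrite -[X in X A]RGenOInfty.measurableE.
apply: smallest_sub => [|B [x ->]]; last exact: approximable_ray.
split; first exact: approximable_set0.
- by move=> B aB; rewrite setTD; exact: approximableC.
- by move=> F aF; exact: approximable_bigcup.
Qed.

End continuous_approximation.

Lemma continuous_test_measure (R : realType) (mu nu : probability R R) (e : R) :
  (forall h : R -> R, unit_continuous h ->
    `|\int[mu]_t h t - \int[nu]_t h t| <= e) ->
  forall A : set R, measurable A -> `|fine (mu A) - fine (nu A)| <= e.
Proof.
move=> He A mA; apply/ler_addgt0Pl => d d0.
have d20 : 0 < d / 2 by rewrite divr_gt0.
have [_ /(_ _ d20) [h uh Hh]] :=
  measurable_approximable (fun b : bool => if b then mu else nu) mA.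
have key (m : probability R R) : \int[m]_t `|h t - \1_A t| <= d / 2 ->
    `|fine (m A) - \int[m]_t h t| <= d / 2.
  have ih : m.-integrable setT (EFin \o h).
    apply: (@integrable_bounded _ _ _ _ _ 1); first exact: continuous_measurable_fun uh.1.
    by move=> t; have := uh.2 t; rewrite ler_norml; lra.
  have iA : m.-integrable setT (EFin \o (\1_A : R -> R)).
    apply: (@integrable_bounded _ _ _ _ _ 1) => // t.
    by rewrite indicE; case: (_ \in _); rewrite ?normr1 ?normr0.
  have -> : fine (m A) = \int[m]_t \1_A t by rewrite /Rintegral integral_indic // setIT.
  apply: le_trans; rewrite distrC -RintegralB //; apply: le_normr_Rintegral => //.
  by apply: (integrableB measurableT ih iA).
have := key _ (Hh true); have := key _ (Hh false); have := He _ uh => /=.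
rewrite !ler_norml; lra.
Qed.

(** * The Stein equation *)

Section stein_equation.
Context {R : realType}.
Notation mu := (@lebesgue_measure R).
Local Notation phi := (normal_pdf (0 : R) 1).
Implicit Types (h : R -> R) (t w : R).

Lemma std_pdfE t : phi t = normal_peak 1 * expR (- (t ^+ 2 / 2)).
Proof.
rewrite normal_pdfE ?oner_neq0 // /normal_fun; congr (_ * expR _).
by rewrite subr0 expr1n mulNr.
Qed.

Lemma std_pdf_gt0 t : 0 < phi t.
Proof. by rewrite std_pdfE mulr_gt0 ?expR_gt0 // normal_peak_gt0 // oner_neq0. Qed.

(** The parameter covers the density (e = -1) and its reciprocal (e = 1), the integrating factor of
    the Stein equation. *)
Lemma is_derive_gauss (e t : R) : is_derive t 1 (fun s => expR (e * (s ^+ 2 / 2)))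
  (e * t * expR (e * (t ^+ 2 / 2))).
Proof.
have H1 : is_derive t 1 (fun s : R => e * (s ^+ 2 / 2)) (e * t).
  apply: is_derive1Z; have /= H := is_derive1Z 2^-1 (is_derive1M (is_derive_id t 1) (is_derive_id t 1)).
  have -> : (fun s => s ^+ 2 / 2) = (fun s : R => 2^-1 * (s * s)).
    by apply/funext => s; rewrite mulrC expr2.
  by apply: (is_derive_eq H); rewrite mulr1; field.
have H := @is_derive1_chain _ expR (fun s => e * (s ^+ 2 / 2)) _ _ _ (is_derive_expR _) H1.
by apply: (is_derive_eq H); rewrite mulrC.
Qed.

Lemma is_derive_std_pdf t : is_derive t 1 phi (- t * phi t).
Proof.
have -> : phi = fun s => normal_peak 1 * expR (-1 * (s ^+ 2 / 2)).
  by apply/funext => s; rewrite std_pdfE mulN1r.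
by apply: (is_derive_eq (is_derive1Z _ (is_derive_gauss _ _))); rewrite mulrCA !mulN1r.
Qed.

(** The change of variables produces a Radon-Nikodym derivative, determined only almost everywhere;
    it is identified with the density by comparing integrals over measurable sets. *)
Lemma Rintegral_std_normal h (D : set R) : measurable D ->
  measurable_fun setT h -> (forall t, `|h t| <= 1) ->
  \int[normal_prob 0 1]_(t in D) h t = \int[mu]_(t in D) (h t * phi t).
Proof.
move=> mD mh hb; rewrite /Rintegral; congr fine.
have dom := @normal_prob_dominates R 0 1.
have ih : (normal_prob 0 1).-integrable D (EFin \o h).
  apply: (integrableS measurableT) => //.
  exact: (@integrable_bounded _ _ _ _ _ 1).
rewrite -(Radon_Nikodym_change_of_variables dom) //=.
under [RHS]eq_integral do rewrite EFinM.
have mE : measurable_fun D (EFin \o h) by apply/measurable_EFinP; exact: measurable_funTS.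
apply: ae_eq_integral => //.
- apply: emeasurable_funM => //; apply: (measurable_int mu).
  by apply: (integrableS _ _ (@subsetT _ _)) => //=; exact: Radon_Nikodym_integrable.
- apply: emeasurable_funM => //=; apply/measurable_EFinP.
  by apply/measurable_funTS; exact: measurable_normal_pdf.
- apply: ae_eqe_mul2l => /=.
  rewrite Radon_NikodymE //=; case: cid => /= g [g1 g2 g3].
  apply: integral_ae_eq => //=.
  + exact: integrableS g2.
  + by apply/measurable_EFinP/measurable_funTS; exact: measurable_normal_pdf.
  + by move=> E ED mE'; rewrite -g3.
Qed.

Section solution.
Variable h : R -> R.
Hypothesis uh : unit_continuous h.

Let c := \int[normal_prob 0 1]_t h t.
Let u t := (h t - c) * phi t.
(** The solution of the Stein equation will be F / phi. Centring [h] at [c] makes the total integral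
    of [u] zero, so [F] vanishes at both infinities. *)
Let F w := \int[mu]_(t in [set` `]-oo, w]]) u t.

Let mh : measurable_fun setT h. Proof. exact: continuous_measurable_fun uh.1. Qed.

Let hb t : `|h t| <= 1.
Proof. by have := uh.2 t; rewrite ler_norml; lra. Qed.

Let c01 : 0 <= c <= 1.
Proof.
rewrite /c Rintegral_ge0 /=; last by move=> t _; have := uh.2 t; lra.
have int1 : \int[normal_prob (0 : R) 1]_t 1 = 1 :> R.
  rewrite Rintegral_cst // mul1r.
  by rewrite [X in fine X](_ : _ = 1%E) //; exact: (probability_setT (normal_prob 0 1)).
rewrite -[X in _ <= X]int1.
apply: le_Rintegral => //; try exact: (@integrable_bounded _ _ _ _ _ 1).
  by apply: (@integrable_bounded _ _ _ _ _ 1) => // t; rewrite normr1.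
by move=> t _; have := uh.2 t; lra.
Qed.

Let u_le t : `|u t| <= phi t.
Proof.
rewrite /u normrM (gtr0_norm (std_pdf_gt0 t)) ler_piMl ?(ltW (std_pdf_gt0 t)) //.
by have := uh.2 t; have := c01; rewrite ler_norml; lra.
Qed.

Let cu : continuous u.
Proof.
move=> t; apply: cvgM; last by apply: continuous_normal_pdf; exact: oner_neq0.
by apply: cvgB; [exact: uh.1|exact: cvg_cst].
Qed.

Let mu_u : measurable_fun setT u. Proof. exact: continuous_measurable_fun. Qed.

Let iphi : mu.-integrable setT (EFin \o phi). Proof. exact: integrable_normal_pdf. Qed.

Let iu : mu.-integrable setT (EFin \o u).
Proof.
apply: (le_integrable _ _ _ iphi) => //; first exact/measurable_EFinP.
move=> t _ /=; rewrite lee_fin (le_trans (u_le t)) //; exact: ler_norm.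
Qed.

Let dF w : is_derive w 1 F (u w).
Proof.
have iw : mu.-integrable [set` `]-oo, (w + 1)]] (EFin \o u) by exact: integrableS iu.
have w1 : w < w + 1 by rewrite ltrDl.
have [d e] := @continuous_FTC1 R u -oo%O w (w + 1) w1 iw (ltNyr _) (@cu w).
by apply: DeriveDef => //; rewrite -derive1E.
Qed.

Let integral_u : \int[mu]_t u t = 0.
Proof.
rewrite /u -Rintegral_std_normal //.
- rewrite RintegralB //; first last.
  + by apply: (@integrable_bounded _ _ _ _ _ 1) => // t; have := c01; rewrite ler_norml; lra.
  + exact: (@integrable_bounded _ _ _ _ _ 1).
  rewrite -/c Rintegral_cst //.
  by rewrite [X in fine X](_ : _ = 1%E) ?mulr1 ?subrr //; exact: (probability_setT (normal_prob 0 1)).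
- by apply: measurable_funB => //; exact: measurable_cst.
- by move=> t; have := c01; have := uh.2 t; rewrite ler_norml; lra.
Qed.

(** Dominated convergence with dominating function [phi]; it serves for [s n] equal to n and to
    -n. *)
Let F_cvg (s : nat -> R) (v : R -> R) : measurable_fun setT v ->
  (forall t, \forall n \near \oo, (u \_ [set` `]-oo, s n]]) t = v t) ->
  F (s n) @[n --> \oo] --> \int[mu]_t v t.
Proof.
move=> mv sv.
have mf n : measurable_fun setT (EFin \o (u \_ [set` `]-oo, s n]])).
  by apply/measurable_EFinP; apply/(measurable_restrictT _ _).1 => //; exact: measurable_funTS.
have H1 : {ae mu, forall t, [set: R] t ->
    (EFin \o (u \_ [set` `]-oo, s n]])) t @[n --> \oo] --> (EFin \o v) t}.
  apply: aeW => t _; apply: cvg_EFin; first by near=> n.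
  apply: cvg_near_cst; near=> n => /=.
  by near: n; exact: sv.
have H3 : {ae mu, forall t n, [set: R] t ->
    (`|(EFin \o (u \_ [set` `]-oo, s n]])) t| <= (EFin \o phi) t)%E}.
  apply: aeW => t n _; rewrite /= lee_fin patchE; case: ifP => // _.
  by rewrite normr0 ltW // std_pdf_gt0.
have [iv _ H] := @dominated_convergence _ _ _ mu _ measurableT _ _ _ mf
  ((measurable_EFinP _ _).2 mv) H1 iphi H3.
have -> : (fun n => F (s n)) = (fun n => \int[mu]_t (u \_ [set` `]-oo, s n]]) t).
  by apply/funext => n; rewrite /F Rintegral_mkcond.
apply: fine_cvg; rewrite fineK; first exact: H.
exact: integrable_fin_num.
Unshelve. all: by end_near. Qed.

Let F_cvg_pinfty : F n%:R @[n --> \oo] --> 0.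
Proof.
rewrite -integral_u; apply: F_cvg => // t.
near=> n; rewrite patchE; case: ifPn => //; rewrite notin_setE /= in_itv /= => /negP.
rewrite -ltNge => H; exfalso; move: H; apply/negP; rewrite -leNgt.
by near: n; exact: nbhs_infty_ger.
Unshelve. all: by end_near. Qed.

Let F_cvg_ninfty : F (- n%:R) @[n --> \oo] --> 0.
Proof.
have -> : 0 = \int[mu]_t (cst 0 t) by rewrite Rintegral_cst // mul0r.
apply: F_cvg => // t.
near=> n; rewrite patchE; case: ifPn => //; rewrite inE /= in_itv /= => H.
exfalso; move: H; apply/negP; rewrite -ltNge.
by rewrite ltrNl; near: n; exact: nbhs_infty_gtr.
Unshelve. all: by end_near. Qed.

Let psi s := phi s / s.

(** The derivative is e u - phi - phi / s^2, which is nonpositive because |u| <= phi. The condition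
    0 < x y keeps the interval away from the pole of [psi] at 0. *)
Let F_psi_decreasing (e x y : R) : `|e| <= 1 -> x < y -> 0 < x * y ->
  e * F y + psi y <= e * F x + psi x.
Proof.
move=> e1 xy xy0.
have s0 s : x <= s <= y -> s != 0.
  by move=> /andP[xs sy]; apply/eqP => s0; rewrite s0 in xs sy; nra.
have dG (s : R) : s != 0 -> is_derive s 1 (fun s => e * F s + psi s)
    (e * u s + (phi s * (- s ^- 2) + s^-1 * (- s * phi s))).
  move=> sn0; apply: is_derive1D; first exact: is_derive1Z.
  apply: is_derive1M; first exact: is_derive_std_pdf.
  by have := is_deriveV sn0 (is_derive_id s 1); rewrite /GRing.scale /= mulr1.
have [|||z zxy] := @MVT R (fun s => e * F s + psi s)
    (fun s => e * u s + (phi s * (- s ^- 2) + s^-1 * (- s * phi s))) x y => //.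
- by move=> s; rewrite in_itv /= => H; apply: dG; apply: s0; lra.
- apply: derivable_within_continuous => s; rewrite in_itv /= => H.
  by apply: ex_derive; apply: dG; exact: s0.
have z0 : z != 0 by apply: s0; move: zxy; rewrite in_itv /=; lra.
rewrite -subr_le0 => ->; rewrite mulr_le0_ge0 //; last by rewrite subr_ge0 ltW.
have H1 : e * u z <= phi z.
  apply: (le_trans (ler_norm _)); rewrite normrM.
  by apply: (le_trans _ (u_le z)); rewrite ler_piMl.
have H2 : 0 <= phi z * z ^- 2 by rewrite mulr_ge0 ?invr_ge0 ?sqr_ge0 // ltW // std_pdf_gt0.
have -> : z^-1 * (- z * phi z) = - phi z by rewrite mulrA mulrN mulVf // mulN1r.
by rewrite mulrN; lra.
Qed.

(** A Mills ratio bound: with e = 1 and e = -1 it says |w F(w)| <= phi(w). It follows by comparing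
    -e F + psi at [w] with its values near the infinity on the same side of 0, where [F] tends to 0
    and the sign of [psi] is known. *)
Let F_tail (e w : R) : `|e| <= 1 -> w != 0 -> w * (e * F w) <= phi w.
Proof.
move=> e1 wn0; have e1' : `|- e| <= 1 by rewrite normrN.
have E : phi w - w * (e * F w) = w * (- e * F w + psi w).
  by rewrite mulrDr /psi [w * (phi w / w)]mulrCA divff // mulr1 mulNr mulrN addrC.
rewrite -subr_ge0 E; move: wn0; rewrite neq_lt => /orP[w0|w0].
- apply: mulr_le0; first exact: ltW.
  have : - e * F (- n%:R) @[n --> \oo] --> - e * 0 by apply: cvgMl_tmp.
  rewrite mulr0; move/cvgr_to_ge; apply.
  near=> n; have wn : - n%:R < w by rewrite ltrNl; near: n; exact: nbhs_infty_gtr.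
  have := F_psi_decreasing e1' wn; rewrite nmulr_rgt0 ?(lt_trans wn) // => /(_ w0) H.
  apply: le_trans H _; rewrite gerDl /psi invrN mulrN oppr_le0 divr_ge0 //.
  by rewrite ltW // std_pdf_gt0.
- apply: mulr_ge0; first exact: ltW.
  have : - e * F n%:R @[n --> \oo] --> - e * 0 by apply: cvgMl_tmp.
  rewrite mulr0; move/cvgr_to_le; apply.
  near=> n; have wn : w < n%:R by near: n; exact: nbhs_infty_gtr.
  have := F_psi_decreasing e1' wn; rewrite pmulr_rgt0 // (lt_trans w0 wn) => /(_ isT) H.
  apply: le_trans H; rewrite lerDl /psi divr_ge0 //.
  by rewrite ltW // std_pdf_gt0.
Unshelve. all: by end_near. Qed.

Lemma stein_solution : exists f f' : R -> R,
  [/\ forall w, is_derive w 1 f (f' w), continuous f', forall w, `|f' w| <= 2 &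
      forall w, f' w - w * f w = h w - \int[normal_prob 0 1]_t h t].
Proof.
(* [g] is 1 / phi. The bound 2 on the derivative is the sum of |h - c| <= 1 and |w f(w)| <= 1, the
   latter being [F_tail]. *)
pose g w := (normal_peak 1)^-1 * expR (1 * (w ^+ 2 / 2)) : R.
have gphi w : phi w * g w = 1.
  rewrite std_pdfE /g mul1r mulrACA divff ?gt_eqF ?normal_peak_gt0 ?oner_neq0 //.
  by rewrite -expRD addNr expR0 mulr1.
have dg w : is_derive w 1 g (w * g w).
  by apply: (is_derive_eq (is_derive1Z _ (is_derive_gauss 1 w))); rewrite mul1r mulrCA.
pose f w := F w * g w.
pose f' w := h w - c + w * f w.
have df w : is_derive w 1 f (f' w).
  apply: (is_derive_eq (is_derive1M (dF w) (dg w))).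
  rewrite /f' /f /u addrC; congr (_ + _); last by rewrite mulrCA.
  by rewrite mulrC -mulrA gphi mulr1.
exists f, f'; split => //.
- move=> w; apply: cvgD; first by apply: cvgB; [exact: uh.1|exact: cvg_cst].
  by apply: cvgM; [exact: cvg_id|exact: is_derive1_continuous (df w)].
- move=> w; have wf : `|w * f w| <= 1.
    have [->|w0] := eqVneq w 0; first by rewrite mul0r normr0.
    have g0 : 0 < g w by rewrite -(pmulr_rgt0 _ (std_pdf_gt0 w)) gphi.
    rewrite /f mulrA normrM (gtr0_norm g0) -(gphi w) ler_pM2r // ler_norml.
    have := @F_tail 1 w; rewrite normr1 mul1r => /(_ (lexx _) w0).
    have := @F_tail (-1) w; rewrite normrN1 mulN1r mulrN => /(_ (lexx _) w0).
    by lra.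
  have := uh.2 w; have := c01; move: wf; rewrite /f' !ler_norml; lra.
- by move=> w; rewrite /f' addrK.
Qed.

End solution.
End stein_equation.

(** * Means over the sphere *)

Section sphere_expectation.
Context {R : realType} {n : nat}.
Local Notation T := (n.-tuple R).
Implicit Types (f g : T -> R) (x : T).

Lemma measurable_sphere : measurable (sphere n : set T).
Proof.
have mf : measurable_fun setT (fun x : T => \sum_(i < n) tnth x i ^+ 2).
  by apply: measurable_sum => i; apply: measurable_funX; exact: measurable_tnth.
have -> : sphere n = setT `&` (fun x : T => \sum_(i < n) tnth x i ^+ 2) @^-1` [set 1].
  by rewrite setTI.
exact: mf.
Qed.

(** Polynomials are unbounded on R^n, so the bound is asked on the sphere only. The class is stable
    under all operations used below and guarantees integrability over the sphere. *)
Definition sphere_bounded f := measurable_fun setT f /\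
  exists M : R, forall x, sphere n x -> `|f x| <= M.

Lemma sphere_bounded_cst (c : R) : sphere_bounded (cst c).
Proof. by split; [exact: measurable_cst|exists `|c|]. Qed.

Lemma sphere_coord_le1 x i : sphere n x -> `|tnth x i| <= 1.
Proof.
move=> sx; rewrite -(@ler_pXn2r _ 2) ?nnegrE // expr1n real_normK ?num_real //.
rewrite -[leRHS]sx (bigD1 i) //= lerDl; apply: sumr_ge0 => j _; exact: sqr_ge0.
Qed.

Lemma sphere_bounded_coord i : sphere_bounded (fun x => tnth x i).
Proof. by split; [exact: measurable_tnth|exists 1 => x; exact: sphere_coord_le1]. Qed.

Lemma sphere_boundedD f g : sphere_bounded f -> sphere_bounded g ->
  sphere_bounded (fun x => f x + g x).
Proof.
move=> [mf [M fM]] [mg [N gN]]; split; first exact: measurable_funD.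
exists (M + N) => x sx; apply: (le_trans (ler_normD _ _)).
by apply: lerD; [exact: fM|exact: gN].
Qed.

Lemma sphere_boundedM f g : sphere_bounded f -> sphere_bounded g ->
  sphere_bounded (fun x => f x * g x).
Proof.
move=> [mf [M fM]] [mg [N gN]]; split; first exact: measurable_funM.
by exists (M * N) => x sx; rewrite normrM ler_pM // ?fM ?gN.
Qed.

Lemma sphere_boundedN f : sphere_bounded f -> sphere_bounded (fun x => - f x).
Proof.
move=> [mf [M fM]]; split; first exact: measurable_funN.
by exists M => x sx; rewrite normrN fM.
Qed.

Lemma sphere_boundedB f g : sphere_bounded f -> sphere_bounded g ->
  sphere_bounded (fun x => f x - g x).
Proof. by move=> bf bg; apply: sphere_boundedD => //; exact: sphere_boundedN. Qed.

Lemma sphere_boundedZ (c : R) f : sphere_bounded f -> sphere_bounded (fun x => c * f x).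
Proof. by apply: sphere_boundedM; exact: sphere_bounded_cst. Qed.

Lemma sphere_bounded_norm f : sphere_bounded f -> sphere_bounded (fun x => `|f x|).
Proof.
move=> [mf [M fM]]; split; first exact: measurableT_comp.
by exists M => x sx; rewrite normr_id fM.
Qed.

Lemma sphere_boundedX f m : sphere_bounded f -> sphere_bounded (fun x => f x ^+ m).
Proof.
move=> [mf [M fM]]; split; first exact: measurable_funX.
exists (M ^+ m) => x sx; rewrite normrX lerXn2r ?nnegrE ?fM //.
exact: le_trans (fM _ sx).
Qed.

Lemma sphere_bounded_sum (I : finType) (F : I -> T -> R) :
  (forall i, sphere_bounded (F i)) -> sphere_bounded (fun x => \sum_i F i x).
Proof.
move=> bF; split; first by apply: measurable_sum => i; case: (bF i).
have /choice [M FM] : forall i, exists M : R, forall x, sphere n x -> `|F i x| <= M.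
  by move=> i; case: (bF i).
exists (\sum_i M i) => x sx; apply: (le_trans (ler_norm_sum _ _ _)).
by apply: ler_sum => i _; exact: FM.
Qed.

Lemma sphere_bounded_comp (u : R -> R) f : continuous u -> sphere_bounded f ->
  sphere_bounded (fun x => u (f x)).
Proof.
move=> cu [mf [M fM]]; split.
  by apply: measurableT_comp => //; exact: continuous_measurable_fun.
(* A negative [M] can bound an absolute value only if the sphere is empty, and then any bound
   holds. *)
have [M0|M0] := leP 0 M; last first.
  by exists 0 => x sx; have := le_trans (normr_ge0 _) (fM x sx); rewrite leNgt M0.
have cu' : {within `[- M, M], continuous (fun t => `|u t|)}.
  by apply: continuous_subspaceT => t; apply: (cvg_norm (cu t)).
have MM : - M <= M by rewrite ge0_cp.
have [c _ cmax] := EVT_max MM cu'.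
exists `|u c| => x sx; apply: cmax; rewrite in_itv /= -ler_norml; exact: fM.
Qed.

Variable sigma : probability T R.
Hypothesis sphere1 : sigma (sphere n) = 1%E.

Definition sphere_mean f := \int[sigma]_(x in sphere n) f x.

Lemma sphere_bounded_integrable f : sphere_bounded f ->
  sigma.-integrable (sphere n) (EFin \o f).
Proof.
move=> [mf [M fM]]; apply: measurable_bounded_integrable.
- exact: measurable_sphere.
- exact: le_lt_trans (probability_le1 sigma measurable_sphere) (ltry _).
- exact: measurable_funTS.
- by exists M; split; [exact: num_real|move=> y My x sx; exact: le_trans (fM x sx) (ltW My)].
Qed.

Lemma sphere_meanD f g : sphere_bounded f -> sphere_bounded g ->
  sphere_mean (fun x => f x + g x) = sphere_mean f + sphere_mean g.
Proof.
by move=> bf bg; apply: RintegralD; [exact: measurable_sphere|exact: sphere_bounded_integrable..].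
Qed.

Lemma sphere_meanB f g : sphere_bounded f -> sphere_bounded g ->
  sphere_mean (fun x => f x - g x) = sphere_mean f - sphere_mean g.
Proof.
by move=> bf bg; apply: RintegralB; [exact: measurable_sphere|exact: sphere_bounded_integrable..].
Qed.

Lemma sphere_meanZ (c : R) f : sphere_bounded f ->
  sphere_mean (fun x => c * f x) = c * sphere_mean f.
Proof.
by move=> bf; apply: RintegralZl; [exact: measurable_sphere|exact: sphere_bounded_integrable..].
Qed.

Lemma sphere_mean_cst (c : R) : sphere_mean (cst c) = c.
Proof.
rewrite /sphere_mean Rintegral_cst; last exact: measurable_sphere.
by rewrite [X in fine X](_ : _ = 1%E) ?mulr1.
Qed.

Lemma eq_sphere_mean f g : (forall x, sphere n x -> f x = g x) ->
  sphere_mean f = sphere_mean g.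
Proof. by move=> fg; apply: eq_Rintegral => x; rewrite inE; exact: fg. Qed.

Lemma le_sphere_mean f g : sphere_bounded f -> sphere_bounded g ->
  (forall x, sphere n x -> f x <= g x) -> sphere_mean f <= sphere_mean g.
Proof.
by move=> bf bg fg; apply: le_Rintegral => //;
  [exact: measurable_sphere|exact: sphere_bounded_integrable..].
Qed.

Lemma sphere_mean_norm f : sphere_bounded f ->
  `|sphere_mean f| <= sphere_mean (fun x => `|f x|).
Proof.
by move=> bf; apply: le_normr_Rintegral;
  [exact: measurable_sphere|exact: sphere_bounded_integrable].
Qed.

Lemma sphere_mean_sum (I : finType) (F : I -> T -> R) :
  (forall i, sphere_bounded (F i)) ->
  sphere_mean (fun x => \sum_i F i x) = \sum_i sphere_mean (F i).
Proof.
move=> bF; rewrite -big_enum /=.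
have -> : (fun x => \sum_i F i x) = (fun x => \sum_(i <- enum I) F i x).
  by apply/funext => x; rewrite big_enum.
elim: (enum I) => [|i s IH].
  by rewrite big_nil -[RHS](sphere_mean_cst 0); apply: eq_sphere_mean => x _; rewrite big_nil.
rewrite big_cons -IH -sphere_meanD //.
  by apply: eq_sphere_mean => x _; rewrite big_cons.
split; first by apply: measurable_sum => k; case: (bF k).
have /choice [M FM] : forall i, exists M : R, forall x, sphere n x -> `|F i x| <= M.
  by move=> k; case: (bF k).
exists (\sum_(k <- s) M k) => x sx; apply: (le_trans (ler_norm_sum _ _ _)).
by apply: ler_sum => k _; exact: FM.
Qed.

End sphere_expectation.

(** * Rotation invariance *)

(* [rot] alone denotes the rotation of sequences of [seq]. *)
Local Notation rot := Defs.rot.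

Section plane_rotations.
Context {R : realType} {n : nat}.
Local Notation T := (n.-tuple R).
Implicit Types (F G : T -> R) (i j k : 'I_n) (x : T) (t : R).

Lemma tnth_rot (Q : 'M[R]_n) x k : tnth (rot Q x) k = \sum_m tnth x m * Q m k.
Proof. by rewrite /rot tnth_mktuple mxE; apply: eq_bigr => m _; rewrite mxE. Qed.

Lemma measurable_rot (Q : 'M[R]_n) : measurable_fun setT (rot Q : T -> T).
Proof.
apply/measurable_fun_tnthP => k.
have -> : (fun x : T => tnth x k) \o rot Q = (fun x => \sum_m tnth x m * Q m k).
  by apply/funext => x /=; rewrite tnth_rot.
by apply: measurable_sum => m; apply: measurable_funM => //; exact: measurable_tnth.
Qed.

Lemma sphere_rot (Q : 'M[R]_n) x : Q *m Q^T = 1%:M -> sphere n (rot Q x) = sphere n x.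
Proof.
move=> QQ; rewrite /sphere /=; congr (_ = 1).
have norm2 y : \sum_(i < n) tnth y i ^+ 2 =
    ((\row_j tnth y j) *m (\row_j tnth y j)^T) 0 0 :> R.
  by rewrite mxE; apply: eq_bigr => i _; rewrite !mxE expr2.
rewrite !norm2; congr (fun_of_matrix _ 0 0).
have -> : \row_j tnth (rot Q x) j = (\row_j tnth x j) *m Q.
  by apply/rowP => k; rewrite mxE tnth_rot mxE; apply: eq_bigr => m _; rewrite mxE.
by rewrite trmx_mul mulmxA -(mulmxA (\row_j _)) QQ mulmx1.
Qed.

Definition plane_mx i j t : 'M[R]_n :=
  1%:M + (cos t - 1) *: (delta_mx i i + delta_mx j j) +
  sin t *: (delta_mx i j - delta_mx j i).

(** With [P] the projection on the plane and [J] its infinitesimal rotation, the relations P^2 = P,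
    PJ = JP = J, J^2 = -P reduce the claim to cos^2 + sin^2 = 1. *)
Lemma plane_mx_orth i j t : i != j -> plane_mx i j t *m (plane_mx i j t)^T = 1%:M.
Proof.
move=> ij; rewrite /plane_mx; set P : 'M[R]_n := delta_mx i i + _; set J : 'M[R]_n := delta_mx i j - _.
have ji : j == i = false by rewrite eq_sym (negbTE ij).
have PP : P *m P = P.
  rewrite /P mulmxDl !mulmxDr !mul_delta_mx_cond !eqxx (negbTE ij) ji.
  by rewrite !mulr0n addr0 add0r.
have PJ : P *m J = J.
  rewrite /P /J mulmxDl !mulmxBr !mul_delta_mx_cond !eqxx (negbTE ij) ji.
  by rewrite !mulr0n !mulr1n subr0 sub0r.
have JP : J *m P = J.
  rewrite /P /J mulmxBl !mulmxDr !mul_delta_mx_cond !eqxx (negbTE ij) ji.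
  by rewrite !mulr0n !mulr1n addr0 add0r.
have JJ : J *m J = - P.
  rewrite /P /J mulmxBl !mulmxBr !mul_delta_mx_cond !eqxx (negbTE ij) ji.
  by rewrite !mulr0n !mulr1n sub0r subr0 opprD.
have PT : P^T = P by rewrite /P raddfD /= !trmx_delta.
have JT : J^T = - J by rewrite /J raddfB /= !trmx_delta opprB.
move: P J PP PJ JP JJ PT JT => P J PP PJ JP JJ PT JT.
have -> : (1%:M + (cos t - 1) *: P + sin t *: J)^T = 1%:M + (cos t - 1) *: P - sin t *: J.
  by rewrite !raddfD /= trmx1 !linearZ /= PT JT scalerN.
have -> : (1%:M + (cos t - 1) *: P + sin t *: J) *m (1%:M + (cos t - 1) *: P - sin t *: J) =
    1%:M + (2 * (cos t - 1) + (cos t - 1) ^+ 2 + sin t ^+ 2) *: P.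
  rewrite !(mulmxDl, mulmxDr) !(mulmxN, mulNmx) !(mul1mx, mulmx1) -!(scalemxAl, scalemxAr).
  rewrite PP PJ JP JJ !scalerA !scalerN.
  by apply/matrixP => a b; rewrite !mxE; ring.
have -> : 2 * (cos t - 1) + (cos t - 1) ^+ 2 + sin t ^+ 2 = 0.
  by have := cos2Dsin2 t; rewrite !expr2 => H; lra.
by rewrite scale0r addr0.
Qed.

Definition plane_rot i j t x : T := rot (plane_mx i j t) x.

Lemma tnth_plane_rot i j t x k : i != j ->
  tnth (plane_rot i j t x) k = tnth x k
   + (k == i)%:R * ((cos t - 1) * tnth x i - sin t * tnth x j)
   + (k == j)%:R * ((cos t - 1) * tnth x j + sin t * tnth x i).
Proof.
move=> ij; rewrite /plane_rot tnth_rot.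
pose d a b := \sum_m tnth x m * (delta_mx a b : 'M[R]_n) m k.
have dE a b : d a b = (k == b)%:R * tnth x a.
  rewrite /d (bigD1 a) //= big1; first by rewrite mxE eqxx addr0 mulrC.
  by move=> m ma; rewrite mxE (negbTE ma) mulr0.
have -> : \sum_m tnth x m * plane_mx i j t m k =
   \sum_m tnth x m * (1%:M : 'M[R]_n) m k + (cos t - 1) * (d i i + d j j) + sin t * (d i j - d j i).
  rewrite /d -sumrN -!big_split /= !mulr_sumr -!big_split /=; apply: eq_bigr => m _.
  by rewrite !mxE; ring.
have -> : \sum_m tnth x m * (1%:M : 'M[R]_n) m k = tnth x k.
  rewrite (bigD1 k) //= big1; first by rewrite mxE eqxx mulr1 addr0.
  by move=> m mk; rewrite mxE (negbTE mk) mulr0.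
rewrite !dE; move: ((k == i)%:R) ((k == j)%:R) (cos t) (sin t) => a b c s; ring.
Qed.

(** The k-th component of the vector field x_i d_j - x_j d_i generating the rotation. *)
Definition rot_speed i j k x : R := (k == j)%:R * tnth x i - (k == i)%:R * tnth x j.

(** The derivative is prescribed at every point of the orbit and not only at t = 0, so that the mean
    value theorem applies along it. *)
Definition plane_derivative i j F G := forall x t,
  is_derive t 1 (fun s => F (plane_rot i j s x)) (G (plane_rot i j t x)).

Lemma plane_derivative_coord i j k : i != j ->
  plane_derivative i j (fun x => tnth x k) (rot_speed i j k).
Proof.
move=> ij x t.
have -> : (fun s => tnth (plane_rot i j s x) k) = (fun s => (tnth x k
   - (k == i)%:R * tnth x i - (k == j)%:R * tnth x j) +
   (((k == i)%:R * tnth x i + (k == j)%:R * tnth x j) * cos s +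
    ((k == j)%:R * tnth x i - (k == i)%:R * tnth x j) * sin s)).
  by apply/funext => s; rewrite tnth_plane_rot //; ring.
have H := is_derive1D (is_derive1Z ((k == i)%:R * tnth x i + (k == j)%:R * tnth x j) (is_derive_cos t))
   (is_derive1Z ((k == j)%:R * tnth x i - (k == i)%:R * tnth x j) (is_derive_sin t)).
apply: (is_derive_eq (is_derive1D (is_derive_cst _ t 1) H)).
have ji : (j == i) = false by rewrite eq_sym (negbTE ij).
rewrite /rot_speed !tnth_plane_rot // !eqxx (negbTE ij) ji /=.
by move: ((k == i)%:R) ((k == j)%:R) (cos t) (sin t) => a b c s; ring.
Qed.

Lemma plane_derivativeM i j F G F' G' : plane_derivative i j F F' ->
  plane_derivative i j G G' ->
  plane_derivative i j (fun x => F x * G x) (fun x => F x * G' x + G x * F' x).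
Proof. by move=> dF dG x t; exact: is_derive1M. Qed.

Lemma plane_derivativeZ i j (c : R) F F' : plane_derivative i j F F' ->
  plane_derivative i j (fun x => c * F x) (fun x => c * F' x).
Proof. by move=> dF x t; exact: is_derive1Z. Qed.

Lemma plane_derivative_sum i j m (F F' : 'I_m -> T -> R) :
  (forall a, plane_derivative i j (F a) (F' a)) ->
  plane_derivative i j (fun x => \sum_a F a x) (fun x => \sum_a F' a x).
Proof. by move=> dF x t; apply: is_derive1_sum => a; exact: dF. Qed.

Lemma plane_derivative_chain i j (u u' : R -> R) F F' :
  (forall w : R, is_derive w 1 u (u' w)) -> plane_derivative i j F F' ->
  plane_derivative i j (fun x => u (F x)) (fun x => u' (F x) * F' x).
Proof.
move=> du dF x t.
exact: (@is_derive1_chain _ u (fun s => F (plane_rot i j s x)) _ _ _ (du _) (dF _ _)).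
Qed.

Lemma plane_rot0 i j x : i != j -> plane_rot i j 0 x = x.
Proof.
move=> ij; apply: eq_from_tnth => k; rewrite tnth_plane_rot // cos0 sin0.
by rewrite subrr !mul0r subr0 addr0 !mulr0 !addr0.
Qed.

End plane_rotations.

Section sphere_integration_by_parts.
Context {R : realType} {n : nat} (sigma : probability (n.-tuple R) R).
Hypothesis usigma : uniform_sphere sigma.
Local Notation T := (n.-tuple R).
Local Notation E := (sphere_mean sigma).

Let sphere1 : sigma (sphere n) = 1%E. Proof. by case: usigma. Qed.

Lemma sphere_bounded_rot (F : T -> R) (Q : 'M[R]_n) : Q *m Q^T = 1%:M ->
  sphere_bounded F -> sphere_bounded (fun x => F (rot Q x)).
Proof.
move=> QQ [mF [M FM]]; split.
  by apply: measurableT_comp => //; exact: measurable_rot.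
by exists M => x sx; apply: FM; rewrite sphere_rot.
Qed.

Lemma sphere_mean_rot (F : T -> R) (Q : 'M[R]_n) : Q *m Q^T = 1%:M ->
  sphere_bounded F -> E (fun x => F (rot Q x)) = E F.
Proof.
move=> QQ bF; rewrite /sphere_mean /Rintegral; congr fine.
have preS : rot Q @^-1` sphere n = sphere n :> set T.
  by apply/seteqP; split => x /=; rewrite sphere_rot.
have := @integral_pushforward _ _ _ _ R _ (measurable_rot Q) sigma (sphere n) (EFin \o F).
rewrite preS => H.
transitivity (\int[pushforward sigma (rot Q)]_(x in sphere n) (EFin \o F) x)%E.
  rewrite H //; first by apply/measurable_EFinP; case: bF.
  - exact/sphere_bounded_integrable/sphere_bounded_rot.
  - exact: measurable_sphere.
apply: eq_measure_integral; first exact: measurable_rot.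
move=> mQ A mA _; rewrite /pushforward /=.
by case: usigma => _; apply.
Qed.

(** Difference quotients of [F] along the rotation have mean zero by invariance and converge
    pointwise to [G]. By the mean value theorem they are values of [G] at points of the orbit, which
    stays on the sphere, so the bound of [G] dominates them. *)
Lemma sphere_ibp (i j : 'I_n) (F G : T -> R) : i != j ->
  sphere_bounded F -> sphere_bounded G -> plane_derivative i j F G -> E G = 0.
Proof.
move=> ij bF bG dF.
have [mG [M GM]] := bG.
pose t (m : nat) : R := (m.+1%:R)^-1.
have t0 m : 0 < t m by rewrite invr_gt0.
pose D m x := m.+1%:R * (F (plane_rot i j (t m) x) - F x).
have orth s := plane_mx_orth s ij.
have bD m : sphere_bounded (D m).
  by apply: sphere_boundedZ; apply: sphere_boundedB => //; exact: sphere_bounded_rot.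
have ED m : E (D m) = 0.
  rewrite sphere_meanZ //; last by apply: sphere_boundedB => //; exact: sphere_bounded_rot.
  rewrite sphere_meanB //; last exact: sphere_bounded_rot.
  by rewrite sphere_mean_rot // subrr mulr0.
have Dle m x : sphere n x -> `|D m x| <= M.
  move=> sx.
  have [|||c _] := @MVT R (fun s => F (plane_rot i j s x)) (fun s => G (plane_rot i j s x)) 0 (t m) => //.
    apply: derivable_within_continuous => s _; exact: ex_derive.
  rewrite plane_rot0 // subr0 => H; rewrite /D H mulrCA divff ?pnatr_eq0 // mulr1.
  by apply: GM; rewrite /plane_rot sphere_rot.
have Dcvg x : D m x @[m --> \oo] --> G x.
  have [d v] := dF x 0.
  have : (fun h : R => h^-1 *: (((fun s => F (plane_rot i j s x)) \o shift 0) (h *: 1) -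
      F (plane_rot i j 0 x))) @ 0^' --> G x by rewrite -[X in _ --> G X](plane_rot0 x ij) -v.
  move/cvgr_dnbhsP => /(_ t); rewrite plane_rot0 // => H.
  have : t @ \oo --> 0 by exact: cvg_harmonic.
  move=> ct; have {}H := H (conj (fun m => lt0r_neq0 (t0 m)) ct).
  apply: cvg_trans H; apply: near_eq_cvg; near=> m.
  by rewrite /D /t /= /GRing.scale /= invrK mulr1 addr0.
have mD m : measurable_fun (sphere n) (EFin \o D m).
  by apply/measurable_EFinP; apply: measurable_funTS; case: (bD m).
have mG' : measurable_fun (sphere n) (EFin \o G).
  by apply/measurable_EFinP; exact: measurable_funTS.
have H1 : {ae sigma, forall x, sphere n x -> (EFin \o D m) x @[m --> \oo] --> (EFin \o G) x}.
  apply: aeW => x sx; apply: cvg_EFin; first by near=> m.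
  exact: Dcvg.
have H2 : sigma.-integrable (sphere n) (EFin \o cst M).
  by apply: sphere_bounded_integrable => //; exact: sphere_bounded_cst.
have H3 : {ae sigma, forall x m, sphere n x -> (`|(EFin \o D m) x| <= (EFin \o cst M) x)%E}.
  by apply: aeW => x m sx; rewrite /= lee_fin; exact: Dle.
have [iG _ H] := @dominated_convergence _ _ _ sigma _ measurable_sphere _ _ _ mD mG' H1 H2 H3.
have : E (D m) @[m --> \oo] --> E G.
  apply: fine_cvg; rewrite fineK; first exact: H.
  by apply: integrable_fin_num => //; exact: measurable_sphere.
have -> : (fun m => E (D m)) = cst 0 by apply/funext => m; exact: ED.
by move/(cvg_lim (@Rhausdorff R)) <-; rewrite lim_cst //; exact: Rhausdorff.
Unshelve. all: by end_near. Qed.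

End sphere_integration_by_parts.

(** * Moments of the coordinates *)

Section sphere_moments.
Context {R : realType} {n : nat} (sigma : probability (n.-tuple R) R).
Hypothesis usigma : uniform_sphere sigma.
Local Notation T := (n.-tuple R).
Local Notation E := (sphere_mean sigma).
Implicit Types (i j : 'I_n) (a b r s : nat).

Let sphere1 : sigma (sphere n) = 1%E. Proof. by case: usigma. Qed.

Lemma is_derive_expn (m : nat) (w : R) :
  is_derive w 1 (fun t : R => t ^+ m) (m%:R * w ^+ m.-1).
Proof.
have := is_derive_poly ('X^m : {poly R}) w; rewrite derivXn_scale hornerZ hornerXn.
by congr (is_derive _ _ _ _); apply/funext => t; rewrite hornerXn.
Qed.

Lemma sphere_bounded_monomial i j a b : sphere_bounded (fun x : T => tnth x i ^+ a * tnth x j ^+ b).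
Proof. by apply: sphere_boundedM; apply: sphere_boundedX; exact: sphere_bounded_coord. Qed.

(** Integration by parts of x_i^a x_j^b. If an exponent is 0, its truncated predecessor is
    multiplied by 0. *)
Lemma monomial_recurrence i j a b : i != j ->
  b%:R * E (fun x => tnth x i ^+ a.+1 * tnth x j ^+ b.-1) =
  a%:R * E (fun x => tnth x i ^+ a.-1 * tnth x j ^+ b.+1).
Proof.
move=> ij; have ji : (j == i) = false by rewrite eq_sym (negbTE ij).
have := sphere_ibp usigma ij (sphere_bounded_monomial i j a b).
pose G (x : T) := b%:R * (tnth x i ^+ a.+1 * tnth x j ^+ b.-1) -
  a%:R * (tnth x i ^+ a.-1 * tnth x j ^+ b.+1).
move=> /(_ G) H; apply/eqP; rewrite -subr_eq0 -!sphere_meanZ -?sphere_meanB //;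
  try by [exact: sphere_bounded_monomial | apply: sphere_boundedZ; exact: sphere_bounded_monomial].
apply/eqP; apply: H.
  by apply: sphere_boundedB; apply: sphere_boundedZ; exact: sphere_bounded_monomial.
have dX k m := plane_derivative_chain (is_derive_expn m) (plane_derivative_coord k ij).
move=> x t; apply: (is_derive_eq (plane_derivativeM (dX i a) (dX j b) x t)).
move: (plane_rot i j t x) => y; rewrite /G /rot_speed !eqxx ji (negbTE ij) !exprS /=.
move: (tnth y i ^+ a) (tnth y j ^+ b) (tnth y i ^+ a.-1) (tnth y j ^+ b.-1).
by move: (tnth y i) (tnth y j) => *; ring.
Qed.

(** The recurrence moves two powers from x_i to x_j, so [b] must vary in the induction; at a = 1 it
    leaves the factor 0. *)
Lemma mean_odd_monomial i j a b : i != j -> odd a ->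
  E (fun x => tnth x i ^+ a * tnth x j ^+ b) = 0.
Proof.
move=> ij; have [m] := ubnP a; elim: m a b => // m IH a b am oa.
have := monomial_recurrence a.-1 b.+1 ij.
have -> : a.-1.+1 = a by lia.
have b0 : b.+1%:R != 0 :> R by rewrite pnatr_eq0.
move=> /= H; apply: (mulfI b0); rewrite mulr0 H.
have [->|a1] := eqVneq a.-1 0%N; first by rewrite mul0r.
by rewrite IH ?mulr0 //; lia.
Qed.

(** The double factorial (2r - 1)!!, that is the Gaussian moment of order 2r. *)
Definition odd_prod r : R := \prod_(k < r) (2 * k + 1)%:R.
Definition dim_prod r : R := \prod_(k < r) (n%:R + (2 * k)%:R).

Hypothesis n3 : (3 <= n)%N.

Let n0 : 0 < n%:R :> R. Proof. by rewrite ltr0n; lia. Qed.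

Lemma dim_prod_gt0 r : 0 < dim_prod r.
Proof. by apply: prodr_gt0 => k _; rewrite ltr_pwDl. Qed.

Lemma moment_even r : moment n%:R (2 * r) = odd_prod r / dim_prod r.
Proof.
rewrite /moment ifF; last by rewrite mul2n odd_double.
have -> : (2 * r)./2 = r by lia.
by rewrite big_split /= prodfV.
Qed.

(** Inserting sum x_j^2 = 1 into the moment of order 2r gives the next moment [A] once for j = i,
    and A / (2r + 1) for each of the n - 1 other indices, by the recurrence. *)
Lemma mean_coord_even i r : E (fun x => tnth x i ^+ (2 * r)) = odd_prod r / dim_prod r.
Proof.
elim: r => [|r IH].
  rewrite muln0 /odd_prod /dim_prod !big_ord0 divr1 -[RHS](sphere_mean_cst sphere1 1).
  by apply: eq_sphere_mean => x _; rewrite expr0.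
set A := E _.
have Aj j : j != i -> (2 * r + 1)%:R * E (fun x => tnth x i ^+ (2 * r) * tnth x j ^+ 2) = A.
  rewrite eq_sym => ij; have := monomial_recurrence (2 * r + 1) 1 ij; rewrite mul1r addn1 /=.
  move=> <-; apply: eq_sphere_mean => x _; rewrite expr0 mulr1; congr (_ ^+ _); lia.
have : E (fun x => tnth x i ^+ (2 * r)) =
    \sum_j E (fun x => tnth x i ^+ (2 * r) * tnth x j ^+ 2).
  rewrite -sphere_mean_sum //; last by move=> j; exact: sphere_bounded_monomial.
  by apply: eq_sphere_mean => x sx; rewrite -mulr_sumr sx mulr1.
rewrite (bigD1 i) //= (eq_bigr (fun _ => A / (2 * r + 1)%:R)); last first.
  by move=> j /Aj <-; rewrite mulrC mulKf // pnatr_eq0 addn1.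
have -> : E (fun x => tnth x i ^+ (2 * r) * tnth x i ^+ 2) = A.
  by apply: eq_sphere_mean => x _; rewrite -exprD; congr (_ ^+ _); lia.
rewrite sumr_const cardC1 card_ord IH -[_ *+ n.-1]mulr_natr => H.
have n1 : n.-1%:R = n%:R - 1 :> R by rewrite -subn1 natrB //; lia.
rewrite /odd_prod /dim_prod !big_ord_recr /= -/(odd_prod r) -/(dim_prod r).
have h1 : (2 * r + 1)%:R != 0 :> R by rewrite pnatr_eq0 addn1.
have h2 : n%:R + (2 * r)%:R != 0 :> R by rewrite gt_eqF // ltr_pwDl.
have h3 : dim_prod r != 0 by rewrite gt_eqF // dim_prod_gt0.
have -> : odd_prod r = (A + A / (2 * r + 1)%:R * (n%:R - 1)) * dim_prod r.
  by rewrite -n1 -H divfK.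
move: h1 h2; rewrite natrD; move: ((2 * r)%:R) => q h1 h2.
by field; rewrite h1 h2 h3.
Qed.

(** The recurrence trades two powers of x_i for two of x_j and keeps r + s fixed, down to the case
    of a single coordinate. *)
Lemma mean_even_monomial i j r s : i != j ->
  E (fun x => tnth x i ^+ (2 * r) * tnth x j ^+ (2 * s)) =
  odd_prod r * odd_prod s / dim_prod (r + s).
Proof.
move=> ij; elim: s r => [|s IH] r.
  rewrite addn0 /odd_prod [in X in _ * X / _]big_ord0 mulr1 -/(odd_prod r) -(mean_coord_even i).
  by apply: eq_sphere_mean => x _; rewrite muln0 mulr1.
have := monomial_recurrence (2 * r + 1) (2 * s + 1) ij.
have -> : ((2 * r + 1).+1 = 2 * r.+1)%N by lia.
have -> : ((2 * s + 1).+1 = 2 * s.+1)%N by lia.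
have -> : ((2 * r + 1).-1 = 2 * r)%N by lia.
have -> : ((2 * s + 1).-1 = 2 * s)%N by lia.
rewrite IH addSnnS => H.
have r0 : (2 * r + 1)%:R != 0 :> R by rewrite pnatr_eq0 addn1.
apply: (mulfI r0); rewrite -H.
have -> : odd_prod r.+1 = odd_prod r * (2 * r + 1)%:R by rewrite /odd_prod big_ord_recr.
have -> : odd_prod s.+1 = odd_prod s * (2 * s + 1)%:R by rewrite /odd_prod big_ord_recr.
ring.
Qed.

Lemma other_coord i : exists j, i != j.
Proof.
have [i0|i0] := eqVneq (i : nat) 0%N.
  have h : (1 < n)%N by lia.
  by exists (Ordinal h); rewrite -val_eqE /= i0.
have h : (0 < n)%N by lia.
by exists (Ordinal h); rewrite -val_eqE.
Qed.

Lemma mean_coord i r : E (fun x => tnth x i ^+ r) = moment n%:R r.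
Proof.
have [or|er] := boolP (odd r); last first.
  have -> : r = (2 * r./2)%N by lia.
  by rewrite mean_coord_even moment_even.
rewrite /moment or; have [j ij] := other_coord i.
rewrite -(mean_odd_monomial 0 ij or).
by apply: eq_sphere_mean => x _; rewrite mulr1.
Qed.

Lemma sphere_bounded_horner (p : {poly R}) i : sphere_bounded (fun x : T => p.[tnth x i]).
Proof.
by apply: sphere_bounded_comp; [exact: continuous_horner|exact: sphere_bounded_coord].
Qed.

Lemma mean_horner (p : {poly R}) i : E (fun x => p.[tnth x i]) = momentum n%:R p.
Proof.
have bX k : sphere_bounded (fun x : T => tnth x i ^+ k).
  by apply: sphere_boundedX; exact: sphere_bounded_coord.
rewrite (@eq_sphere_mean _ _ sigma _ (fun x => \sum_(k < size p) p`_k * tnth x i ^+ k)).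
  rewrite sphere_mean_sum //; last by move=> k; exact: sphere_boundedZ.
  by apply: eq_bigr => k _; rewrite sphere_meanZ // mean_coord.
by move=> x _; rewrite horner_coef.
Qed.

Definition odd_poly_pred (p : {poly R}) := forall k, ~~ odd k -> p`_k = 0.

Lemma mean_odd_product (p q : {poly R}) i j : i != j -> odd_poly_pred p ->
  E (fun x => p.[tnth x i] * q.[tnth x j]) = 0.
Proof.
move=> ij op.
have bX a b := sphere_bounded_monomial i j a b.
rewrite (@eq_sphere_mean _ _ sigma _ (fun x => \sum_(k < size p) \sum_(m < size q)
   (p`_k * q`_m) * (tnth x i ^+ k * tnth x j ^+ m))); last first.
  move=> x _; rewrite !horner_coef big_distrlr /=; apply: eq_bigr => k _.
  by apply: eq_bigr => m _; rewrite mulrACA.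
rewrite sphere_mean_sum //; last first.
  by move=> k; apply: sphere_bounded_sum => m; exact: sphere_boundedZ.
apply: big1 => k _; rewrite sphere_mean_sum //; last by move=> m; exact: sphere_boundedZ.
apply: big1 => m _; rewrite sphere_meanZ //.
have [ok|/op ->] := boolP (odd k); last by rewrite !mul0r.
by rewrite mean_odd_monomial // mulr0.
Qed.

(** Each step multiplies by n / (n + 2m) >= 1 - 2m/n; for a, b <= 1 one has a b >= a + b - 1, so the
    losses add up, and m^2 + 2m <= (m + 1)^2. *)
Lemma dim_ratio_bounds m :
  1 - (m ^ 2)%:R / n%:R <= n%:R ^+ m / dim_prod m <= 1.
Proof.
elim: m => [|m /andP[IH1 IH2]].
  by rewrite /dim_prod big_ord0 expr0 divr1 mul0r subr0 lexx.
set a := n%:R ^+ m / dim_prod m in IH1 IH2.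
have m0 : 0 <= (2 * m)%:R :> R by [].
have h : 0 < n%:R + (2 * m)%:R :> R by rewrite ltr_pwDl.
have a0 : 0 <= a by rewrite divr_ge0 ?exprn_ge0 // ltW // dim_prod_gt0.
have -> : n%:R ^+ m.+1 / dim_prod m.+1 = a * (n%:R / (n%:R + (2 * m)%:R)).
  rewrite /a /dim_prod big_ord_recr /= -/(dim_prod m) exprSr.
  have h1 : dim_prod m != 0 by rewrite gt_eqF // dim_prod_gt0.
  have h2 : n%:R + (2 * m)%:R != 0 :> R by rewrite gt_eqF.
  by move: h1 h2; move: (dim_prod m) ((2 * m)%:R : R) => *; field; apply/andP.
set b := n%:R / (n%:R + (2 * m)%:R).
have b1 : b <= 1 by rewrite ler_pdivrMr // mul1r lerDl.
have b0 : 0 <= b by rewrite divr_ge0 // ltW.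
have b2 : 1 - (2 * m)%:R / n%:R <= b.
  rewrite ler_pdivlMr // mulrBl mul1r -subr_ge0.
  have -> : n%:R - (n%:R + (2 * m)%:R - (2 * m)%:R / n%:R * (n%:R + (2 * m)%:R)) =
     (2 * m)%:R * (2 * m)%:R / n%:R :> R.
    by move: (gt_eqF n0) => /negbT n0'; move: ((2 * m)%:R : R) => q; field.
  by rewrite divr_ge0 // mulr_ge0.
apply/andP; split; last by rewrite mulr_ile1.
have -> : (m.+1 ^ 2)%:R = (m ^ 2)%:R + (2 * m)%:R + 1 :> R.
  by rewrite -!natrD natr1; congr (_%:R); lia.
rewrite !mulrDl mul1r; have : 0 < n%:R^-1 :> R by rewrite invr_gt0.
have : 0 <= (1 - a) * (1 - b) by rewrite mulr_ge0 // subr_ge0.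
by move=> ? ?; lra.
Qed.

(** The joint moment and the product of moments carry the same factor [odd_prod r * odd_prod s].
    What remains of each lies between 1 - (r + s)^2 / n and 1. *)
Lemma rescaled_covariance i j r s : i != j ->
  `|n%:R ^+ r * n%:R ^+ s * E (fun x => tnth x i ^+ (2 * r) * tnth x j ^+ (2 * s)) -
    (n%:R ^+ r * moment n%:R (2 * r)) * (n%:R ^+ s * moment n%:R (2 * s))| <=
  odd_prod r * odd_prod s * (((r + s) ^ 2)%:R / n%:R).
Proof.
move=> ij; rewrite mean_even_monomial // !moment_even.
have O0 m : 0 <= odd_prod m by apply: prodr_ge0.
have -> : n%:R ^+ r * n%:R ^+ s * (odd_prod r * odd_prod s / dim_prod (r + s)) -
    n%:R ^+ r * (odd_prod r / dim_prod r) * (n%:R ^+ s * (odd_prod s / dim_prod s)) =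
    odd_prod r * odd_prod s * (n%:R ^+ (r + s) / dim_prod (r + s) -
     (n%:R ^+ r / dim_prod r) * (n%:R ^+ s / dim_prod s)).
  by rewrite exprD; ring.
rewrite normrM ger0_norm ?mulr_ge0 // ler_wpM2l ?mulr_ge0 //.
have /andP[] := dim_ratio_bounds (r + s).
have /andP[] := dim_ratio_bounds r; have /andP[] := dim_ratio_bounds s.
set a := _ / dim_prod r; set b := _ / dim_prod s; set c := _ / dim_prod (r + s).
have a0 : 0 <= a by rewrite divr_ge0 ?exprn_ge0 // ltW // dim_prod_gt0.
have b0 : 0 <= b by rewrite divr_ge0 ?exprn_ge0 // ltW // dim_prod_gt0.
move=> b1 b2 a1 a2 c1 c2.
have H : (r ^ 2)%:R / n%:R + (s ^ 2)%:R / n%:R <= ((r + s) ^ 2)%:R / n%:R :> R.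
  by rewrite -mulrDl ler_pM2r ?invr_gt0 // -natrD ler_nat; lia.
have H1 : 0 <= (1 - a) * (1 - b) by rewrite mulr_ge0 // subr_ge0.
have H2 : a * b <= 1 by rewrite mulr_ile1.
by rewrite ler_norml; apply/andP; split; lra.
Qed.

Lemma odd_prod_le r s : (r <= s)%N -> odd_prod r <= odd_prod s.
Proof.
elim: s => [|s IH]; first by rewrite leqn0 => /eqP ->.
rewrite leq_eqVlt => /orP[/eqP -> //|]; rewrite ltnS => /IH H; apply: le_trans H _.
rewrite /odd_prod big_ord_recr /= ler_peMr ?prodr_ge0 // ler1n; lia.
Qed.

Lemma rescaled_moment_bound r :
  0 <= n%:R ^+ r * moment (n%:R : R) (2 * r) <= odd_prod r.
Proof.
rewrite moment_even mulrCA.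
have O0 m : 0 <= odd_prod m by apply: prodr_ge0.
have /andP[_ h] := dim_ratio_bounds r.
rewrite mulr_ge0 ?ler_piMr //.
by rewrite divr_ge0 ?exprn_ge0 // ltW // dim_prod_gt0.
Qed.

End sphere_moments.

(** * The Stein identity *)

Section stein_identity.
Context {R : realType} {n : nat} (sigma : probability (n.-tuple R) R).
Hypothesis usigma : uniform_sphere sigma.
Local Notation T := (n.-tuple R).
Local Notation E := (sphere_mean sigma).
Variables (q : {poly R}) (lam : R) (a : T).
Hypothesis ode : (1 - 'X^2) * q^`()^`() - (n%:R - 1) *: ('X * q^`()) = - lam *: q.

Let sphere1 : sigma (sphere n) = 1%E. Proof. by case: usigma. Qed.

Definition coord_comb (x : T) : R := \sum_i tnth a i * q.[tnth x i].

(* The squared norm of the spherical gradient of [coord_comb]. *)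
Definition grad_sqr (x : T) : R := \sum_i tnth a i ^+ 2 * q^`().[tnth x i] ^+ 2 -
  (\sum_i tnth a i * (tnth x i * q^`().[tnth x i])) ^+ 2.

Lemma sphere_bounded_coord_comb : sphere_bounded coord_comb.
Proof.
by apply: sphere_bounded_sum => i; apply: sphere_boundedZ; exact: sphere_bounded_horner.
Qed.

Lemma sphere_bounded_grad_sqr : sphere_bounded grad_sqr.
Proof.
apply: sphere_boundedB.
  apply: sphere_bounded_sum => i; apply: sphere_boundedZ; apply: sphere_boundedX.
  exact: sphere_bounded_horner.
apply: sphere_boundedX; apply: sphere_bounded_sum => i; apply: sphere_boundedZ.
by apply: sphere_boundedM; [exact: sphere_bounded_coord|exact: sphere_bounded_horner].
Qed.

Lemma ode_horner t : (1 - t ^+ 2) * q^`()^`().[t] - (n%:R - 1) * (t * q^`().[t]) = - lam * q.[t].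
Proof. by have := congr1 (horner^~ t) ode; rewrite !hornerE. Qed.

Variables g g' : R -> R.
Hypothesis dg : forall w : R, is_derive w 1 g (g' w).
Hypothesis cg' : continuous g'.

Let cg : continuous g. Proof. by move=> w; exact: is_derive1_continuous (dg w). Qed.

(** The derivative of g(p) a_j x_i q'(x_j) along x_i d_j - x_j d_i. Summed over [i], its first part
    builds the differential equation at x_j and its second part the squared gradient. *)
Let G i j (x : T) : R :=
  g (coord_comb x) * (tnth a j * (tnth x i ^+ 2 * q^`()^`().[tnth x j] - tnth x j * q^`().[tnth x j])) +
  (tnth a j * (tnth x i * q^`().[tnth x j])) * (g' (coord_comb x) *
    (tnth a j * (q^`().[tnth x j] * tnth x i) - tnth a i * (q^`().[tnth x i] * tnth x j))).

Let bq i (p : {poly R}) := @sphere_bounded_horner R n p i.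

Let bG i j : sphere_bounded (G i j).
Proof.
have bx := @sphere_bounded_coord R n.
have bp := sphere_bounded_coord_comb.
apply: sphere_boundedD; apply: sphere_boundedM.
- exact: sphere_bounded_comp.
- apply: sphere_boundedZ; apply: sphere_boundedB; apply: sphere_boundedM => //.
  exact: sphere_boundedX.
- by apply: sphere_boundedZ; apply: sphere_boundedM.
- apply: sphere_boundedM; first exact: sphere_bounded_comp.
  by apply: sphere_boundedB; apply: sphere_boundedZ; apply: sphere_boundedM.
Qed.

Let EG i j : i != j -> E (G i j) = 0.
Proof.
move=> ij; have ji : (j == i) = false by rewrite eq_sym (negbTE ij).
have bx := @sphere_bounded_coord R n.
pose F (x : T) := g (coord_comb x) * (tnth a j * (tnth x i * q^`().[tnth x j])).
apply: (@sphere_ibp _ _ _ usigma i j F _ ij _ (bG i j)).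
  apply: sphere_boundedM; first by apply: sphere_bounded_comp => //; exact: sphere_bounded_coord_comb.
  by apply: sphere_boundedZ; exact: sphere_boundedM.
have dP (p : {poly R}) k : plane_derivative i j (fun x : T => p.[tnth x k])
    (fun x => p^`().[tnth x k] * rot_speed i j k x).
  exact: (@plane_derivative_chain R n i j (horner p) (horner p^`()) _ _
    (is_derive_poly p) (plane_derivative_coord k ij)).
have dp : plane_derivative i j coord_comb
    (fun x => tnth a j * (q^`().[tnth x j] * tnth x i) - tnth a i * (q^`().[tnth x i] * tnth x j)).
  have D := plane_derivative_sum (fun k => plane_derivativeZ (tnth a k) (dP q k)).
  move=> x t; apply: (is_derive_eq (D x t)).
  move: (plane_rot i j t x) => y; rewrite /rot_speed (bigD1 j) //= (bigD1 i) //= big1.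
    by rewrite !eqxx ji (negbTE ij) /=; ring.
  by move=> k /andP[/negbTE -> /negbTE ->]; rewrite !mul0r subr0 !mulr0.
have D := plane_derivativeM (plane_derivative_chain dg dp)
  (plane_derivativeZ (tnth a j) (plane_derivativeM (plane_derivative_coord i ij) (dP q^`() j))).
move=> x t; apply: (is_derive_eq (D x t)).
by move: (plane_rot i j t x) => y; rewrite /G /rot_speed !eqxx ji (negbTE ij) /=; ring.
Qed.

Lemma stein_identity :
  lam * E (fun x => g (coord_comb x) * coord_comb x) = E (fun x => g' (coord_comb x) * grad_sqr x).
Proof.
have bp := sphere_bounded_coord_comb; have bS := sphere_bounded_grad_sqr.
have bgp : sphere_bounded (fun x : T => g (coord_comb x)) by exact: sphere_bounded_comp.
have bg'p : sphere_bounded (fun x : T => g' (coord_comb x)) by exact: sphere_bounded_comp.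
rewrite -sphere_meanZ //; last exact: sphere_boundedM.
apply/eqP; rewrite eq_sym -subr_eq0 -sphere_meanB //; first last.
- by apply: sphere_boundedZ; exact: sphere_boundedM.
- exact: sphere_boundedM.
apply/eqP; transitivity (\sum_j \sum_(i | i != j) E (G i j)); last first.
  by apply: big1 => j _; apply: big1 => i ij; exact: EG.
have -> : \sum_j \sum_(i | i != j) E (G i j) =
    \sum_j E (fun x => \sum_i (i != j)%:R * G i j x).
  apply: eq_bigr => j _; rewrite sphere_mean_sum //; last by move=> i; exact: sphere_boundedZ.
  rewrite big_mkcond /=; apply: eq_bigr => i _; rewrite sphere_meanZ //.
  by case: (i != j); rewrite ?mul1r ?mul0r.
rewrite -sphere_mean_sum //; last first.
  by move=> j; apply: sphere_bounded_sum => i; exact: sphere_boundedZ.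
apply: eq_sphere_mean => x sx.
set V := \sum_i tnth a i * (tnth x i * q^`().[tnth x i]).
have inner j : \sum_i (i != j)%:R * G i j x =
    g' (coord_comb x) * (tnth a j ^+ 2 * q^`().[tnth x j] ^+ 2
       - tnth a j * (tnth x j * q^`().[tnth x j]) * V)
    - lam * g (coord_comb x) * (tnth a j * q.[tnth x j]).
  (* Restoring the diagonal term makes the sum over [i] complete, so that sum x_i^2 = 1 can be used.
     The full sum gives q'' - n x_j q'; removing the diagonal turns it into (1 - x_j^2) q'' - (n -
     1) x_j q'. *)
  transitivity (\sum_i G i j x - G j j x).
    rewrite (bigD1 j) //= eqxx mul0r add0r [in RHS](bigD1 j) //= addrAC subrr add0r.
    by apply: eq_bigr => i ->; rewrite mul1r.
  have -> : \sum_i G i j x =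
     g (coord_comb x) * (tnth a j * (q^`()^`().[tnth x j] - n%:R * (tnth x j * q^`().[tnth x j]))) +
     g' (coord_comb x) * (tnth a j ^+ 2 * q^`().[tnth x j] ^+ 2
       - tnth a j * (tnth x j * q^`().[tnth x j]) * V).
    rewrite /G big_split /= -!mulr_sumr sumrB -mulr_suml sx mul1r sumr_const card_ord.
    rewrite -[_ *+ n]mulr_natl; congr (_ + _).
    pose A := tnth a j * q^`().[tnth x j].
    transitivity (\sum_i (g' (coord_comb x) * A ^+ 2 * tnth x i ^+ 2 -
       g' (coord_comb x) * A * tnth x j * (tnth a i * (tnth x i * q^`().[tnth x i])))).
      by apply: eq_bigr => i _; rewrite /A; ring.
    by rewrite sumrB -!mulr_sumr sx -/V /A; ring.
  have lq : lam * q.[tnth x j] = - ((1 - tnth x j ^+ 2) * q^`()^`().[tnth x j] -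
      (n%:R - 1) * (tnth x j * q^`().[tnth x j])) by rewrite ode_horner mulNr opprK.
  have -> : lam * g (coord_comb x) * (tnth a j * q.[tnth x j]) =
    g (coord_comb x) * tnth a j * (lam * q.[tnth x j]) by ring.
  by rewrite lq /G; ring.
under eq_bigr do rewrite inner.
rewrite sumrB -!mulr_sumr sumrB -mulr_suml -/V /grad_sqr -/V -/(coord_comb x).
by rewrite [RHS]/=; ring.
Qed.

End stein_identity.

(** * Polynomials in n t^2 with bounded coefficients *)

Lemma ler_sum_card (R : realType) (I : finType) (F : I -> R) (c : R) :
  (forall i, `|F i| <= c) -> `|\sum_i F i| <= #|I|%:R * c.
Proof.
move=> Fc; apply: (le_trans (ler_norm_sum _ _ _)).
apply: (@le_trans _ _ (\sum_(i : I) c)); first exact: ler_sum.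
by rewrite sumr_const mulr_natl.
Qed.

Section rescaled_polynomials.
Context {R : realType} {n : nat} (n3 : (3 <= n)%N).

(** An arbitrary index type allows repeated exponents: the expansion of q'^2 is indexed by pairs,
    and squaring passes to pairs again without collecting terms. *)
Definition rescaled_poly (I : finType) (g : I -> R) (r : I -> nat) : {poly R} :=
  \sum_i (g i * n%:R ^+ r i) *: 'X^(2 * r i).

Lemma momentum_rescaled_bound (I : finType) (g : I -> R) (r : I -> nat) (K : R) (L : nat) :
  (forall i, `|g i| <= K) -> (forall i, r i <= L)%N ->
  `|momentum n%:R (rescaled_poly g r)| <= #|I|%:R * (K * odd_prod L).
Proof.
move=> gK rL; rewrite /rescaled_poly momentum_sum; apply: ler_sum_card => i.
rewrite momentumZ momentumXn -mulrA normrM.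
have /andP[m0 m1] := @rescaled_moment_bound R n n3 (r i).
rewrite (ger0_norm m0); apply: ler_pM => //.
by apply: le_trans m1 _; exact: odd_prod_le.
Qed.

Lemma rescaled_poly_sqr (I : finType) (g : I -> R) (r : I -> nat) :
  rescaled_poly g r ^+ 2 =
  rescaled_poly (fun t : I * I => g t.1 * g t.2) (fun t => r t.1 + r t.2)%N.
Proof.
rewrite /rescaled_poly expr2 big_distrlr /= pair_bigA /=; apply: eq_bigr => t _.
by rewrite -scalerAl -scalerAr scalerA -exprD -mulnDr; congr (_ *: _); rewrite exprD mulrACA.
Qed.

Variables (sigma : probability (n.-tuple R) R) (usigma : uniform_sphere sigma).
Local Notation E := (sphere_mean sigma).

Let sphere1 : sigma (sphere n) = 1%E. Proof. by case: usigma. Qed.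

Lemma rescaled_poly_covariance (I : finType) (g : I -> R) (r : I -> nat) (K : R) (L : nat)
    (i j : 'I_n) : i != j ->
  (forall t, `|g t| <= K) -> (forall t, r t <= L)%N ->
  `|E (fun x => (rescaled_poly g r).[tnth x i] * (rescaled_poly g r).[tnth x j]) -
    momentum n%:R (rescaled_poly g r) ^+ 2| <=
  #|{: I * I}|%:R * (K ^+ 2 * (odd_prod L ^+ 2 * ((2 * L) ^ 2)%:R)) / n%:R.
Proof.
move=> ij gK rL; set p := rescaled_poly g r.
have n0 : 0 < n%:R :> R by rewrite ltr0n; lia.
have O0 m : 0 <= odd_prod m :> R by apply: prodr_ge0.
pose c (t : I * I) (x : n.-tuple R) := (g t.1 * g t.2 * (n%:R ^+ r t.1 * n%:R ^+ r t.2)) *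
  (tnth x i ^+ (2 * r t.1) * tnth x j ^+ (2 * r t.2)).
have -> : E (fun x => p.[tnth x i] * p.[tnth x j]) = \sum_t E (c t).
  rewrite -sphere_mean_sum //; last first.
    by move=> t; apply: sphere_boundedZ; exact: sphere_bounded_monomial.
  apply: eq_sphere_mean => x _; rewrite /p /rescaled_poly !horner_sum big_distrlr /= pair_bigA /=.
  by apply: eq_bigr => t _; rewrite !hornerZ !hornerXn /c; ring.
have -> : momentum n%:R p ^+ 2 = \sum_(t : I * I) g t.1 * g t.2 *
    ((n%:R ^+ r t.1 * moment n%:R (2 * r t.1)) * (n%:R ^+ r t.2 * moment n%:R (2 * r t.2))).
  rewrite /p /rescaled_poly momentum_sum expr2 big_distrlr /= pair_bigA /=.
  by apply: eq_bigr => t _; rewrite !momentumZ !momentumXn; ring.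
rewrite -sumrB -mulrA; apply: ler_sum_card => t.
rewrite /c sphere_meanZ //; last exact: sphere_bounded_monomial.
rewrite -mulrA -mulrBr normrM -[X in _ <= X]mulrA; apply: ler_pM => //.
  by rewrite expr2 normrM; apply: ler_pM.
apply: (le_trans (rescaled_covariance usigma n3 (r t.1) (r t.2) ij)).
rewrite -[X in _ <= X]mulrA; apply: ler_pM; rewrite ?mulr_ge0 ?divr_ge0 //.
  by rewrite expr2; apply: ler_pM => //; exact: odd_prod_le.
rewrite ler_pM2r ?invr_gt0 // ler_nat leq_sqr mul2n -addnn; exact: leq_add.
Qed.

End rescaled_polynomials.

(** * Concentration of the squared gradient *)

Section gradient_concentration.
Context {R : realType} {n l : nat} (n3 : (3 <= n)%N) (ol : odd l).
Variables (sigma : probability (n.-tuple R) R) (usigma : uniform_sphere sigma).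
Local Notation T := (n.-tuple R).
Local Notation E := (sphere_mean sigma).
Local Notation q := (harm_poly R n l).
Local Notation lam := (harm_eigenvalue R n l).

Let sphere1 : sigma (sphere n) = 1%E. Proof. by case: usigma. Qed.
Let n0 : 0 < n%:R :> R. Proof. by rewrite ltr0n; lia. Qed.
Let lam0 : 0 < lam. Proof. exact: harm_eigenvalue_gt0. Qed.

Variables (I : finType) (g : I -> R) (r : I -> nat) (K : R).
Hypothesis K0 : 0 <= K.
Hypothesis gK : forall t, `|g t| <= K.
Hypothesis rl : forall t, (r t < l)%N.
Hypothesis expansion : lam^-1 *: q^`() ^+ 2 = @rescaled_poly R n I g r.

Let G : {poly R} := lam^-1 *: q^`() ^+ 2.
Let m := momentum n%:R G.
Let delta := momentum n%:R ('X^2 * G).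

Let m_delta : m = 1 + delta.
Proof.
have H : momentum n%:R ((1 - 'X^2) * G) = 1.
  by rewrite /G -scalerAr momentumZ momentum_deriv_harm_sqr // mulVf // gt_eqF.
by rewrite -H -momentumD -mulrDl subrK mul1r.
Qed.

(** Multiplying by t^2 raises each [r] by one at the price of a factor 1/n, and rescaled polynomials
    have bounded mean. *)
Let delta_bound : `|delta| <= #|I|%:R * (K * odd_prod l) / n%:R.
Proof.
have -> : delta = n%:R^-1 * momentum n%:R (@rescaled_poly R n I g (fun t => (r t).+1)).
  rewrite /delta /G expansion -momentumZ; congr (momentum _ _).
  rewrite /rescaled_poly mulr_sumr scaler_sumr; apply: eq_bigr => t _.
  rewrite -scalerAr -exprD scalerA; congr (_ *: 'X^ _); last by lia.
  by rewrite exprS mulrCA mulKf // gt_eqF.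
rewrite normrM [leLHS]mulrC [`|n%:R^-1|]ger0_norm ?invr_ge0 ?(ltW n0) //.
apply: ler_wpM2r; first by rewrite invr_ge0 ltW.
exact: momentum_rescaled_bound.
Qed.

Let odd_deriv : odd_poly_pred ('X * q^`()).
Proof.
have oq k : ~~ odd k -> q`_k = 0.
  move=> ek; rewrite /harm_poly coefZ /gegen_poly coef_sum big1 ?mulr0 // => j _.
  rewrite coefZ coefXn; case: eqP => [ke|]; last by rewrite mulr0.
  by exfalso; have := ltn_ord j; lia.
move=> k ek; rewrite coefXM; case: eqP => // k0; rewrite coef_deriv prednK ?lt0n; last exact/eqP.
by rewrite oq // mul0rn.
Qed.

Variable a : T.
Hypothesis a1 : sphere n a.

Let s4 := \sum_i tnth a i ^+ 4.

(** The decomposition behind the estimate is 1 - |grad p|^2 / lam = - Y - delta + U, where [Y] is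
    centred and [U] is the nonnegative contribution of the radial derivative. *)
Let Y (x : T) := \sum_i tnth a i ^+ 2 * (G.[tnth x i] - m).
Let U (x : T) := lam^-1 * (\sum_i tnth a i * (tnth x i * q^`().[tnth x i])) ^+ 2.

Let bY : sphere_bounded Y.
Proof.
apply: sphere_bounded_sum => i; apply: sphere_boundedZ; apply: sphere_boundedB.
  exact: sphere_bounded_horner.
exact: sphere_bounded_cst.
Qed.

Let bU : sphere_bounded U.
Proof.
apply: sphere_boundedZ; apply: sphere_boundedX; apply: sphere_bounded_sum => i.
by apply: sphere_boundedZ; apply: sphere_boundedM;
  [exact: sphere_bounded_coord|exact: sphere_bounded_horner].
Qed.

(** The polynomial t q'(t) is odd, so products at two distinct coordinates have mean zero; the
    diagonal terms are weighted by a_i^2, which sum to 1. *)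
Let EU : E U = delta.
Proof.
rewrite /U sphere_meanZ //; last first.
  apply: sphere_boundedX; apply: sphere_bounded_sum => i.
  by apply: sphere_boundedZ; apply: sphere_boundedM;
    [exact: sphere_bounded_coord|exact: sphere_bounded_horner].
pose v := 'X * q^`().
have bv i j : sphere_bounded (fun x : T => v.[tnth x i] * v.[tnth x j]).
  by apply: sphere_boundedM; exact: sphere_bounded_horner.
have -> : E (fun x => (\sum_i tnth a i * (tnth x i * q^`().[tnth x i])) ^+ 2) =
   \sum_i \sum_j (tnth a i * tnth a j) * E (fun x => v.[tnth x i] * v.[tnth x j]).
  rewrite (@eq_sphere_mean _ _ sigma _ (fun x => \sum_i \sum_j
     (tnth a i * tnth a j) * (v.[tnth x i] * v.[tnth x j]))); last first.
    move=> x _; rewrite expr2 big_distrlr /=; apply: eq_bigr => i _; apply: eq_bigr => j _.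
    by rewrite /v !hornerM !hornerX; ring.
  rewrite sphere_mean_sum //; last first.
    by move=> i; apply: sphere_bounded_sum => j; exact: sphere_boundedZ.
  apply: eq_bigr => i _; rewrite sphere_mean_sum //; last by move=> j; exact: sphere_boundedZ.
  by apply: eq_bigr => j _; rewrite sphere_meanZ.
rewrite (eq_bigr (fun i => tnth a i ^+ 2 * (lam * delta))) => [|i _].
  by rewrite -mulr_suml a1 mul1r mulKf // gt_eqF.
rewrite (bigD1 i) //= big1 => [|j ji]; last first.
  by rewrite mean_odd_product ?mulr0 // eq_sym.
rewrite addr0 -expr2; congr (_ * _).
have -> : E (fun x => v.[tnth x i] * v.[tnth x i]) = momentum n%:R (v ^+ 2).
  rewrite -(mean_horner usigma n3 _ i).
  by apply: eq_sphere_mean => x _; rewrite -hornerM -expr2.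
rewrite /delta /G -scalerAr momentumZ mulrA mulfV ?gt_eqF // mul1r.
by rewrite /v exprMn.
Qed.

(** [V] will bound the variance of [G] at one coordinate, and C / n its covariance at two distinct
    ones. *)
Let V := #|{: I * I}|%:R * (K ^+ 2 * odd_prod (l + l)).
Let C := #|{: I * I}|%:R * (K ^+ 2 * (odd_prod l ^+ 2 * ((2 * l) ^ 2)%:R)).

(** The difference is the sum of the squares (a_i^2 - 1/n)^2. *)
Let inv_n_s4 : n%:R^-1 <= s4.
Proof.
have : 0 <= \sum_(i < n) (tnth a i ^+ 2 - n%:R^-1) ^+ 2 by apply: sumr_ge0 => i _; exact: sqr_ge0.
have -> : \sum_(i < n) (tnth a i ^+ 2 - n%:R^-1) ^+ 2 = s4 - n%:R^-1.
  rewrite (eq_bigr (fun i => tnth a i ^+ 4 - 2 * n%:R^-1 * tnth a i ^+ 2 + n%:R^-1 ^+ 2)).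
    rewrite !big_split /= sumrN -mulr_sumr a1 -/s4 sumr_const card_ord -mulr_natl.
    by move: (gt_eqF n0) => /negbT h; field.
  by move=> i _; ring.
by rewrite subr_ge0.
Qed.

Let s4_le1 : s4 <= 1.
Proof.
rewrite -a1; apply: ler_sum => i _.
have h : `|tnth a i| ^+ 2 <= 1 by rewrite exprn_ile1 // sphere_coord_le1.
rewrite real_normK ?num_real // in h.
by rewrite -[4%N]/(2 + 2)%N exprD ler_piMr // sqr_ge0.
Qed.

Let EY2 : E (fun x => Y x ^+ 2) <= (V + C) * s4.
Proof.
have bg i : sphere_bounded (fun x : T => G.[tnth x i]) by exact: sphere_bounded_horner.
have bgm i : sphere_bounded (fun x : T => G.[tnth x i] - m).
  by apply: sphere_boundedB => //; exact: sphere_bounded_cst.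
pose cov i j := E (fun x => (G.[tnth x i] - m) * (G.[tnth x j] - m)).
have covE i j : cov i j = E (fun x => G.[tnth x i] * G.[tnth x j]) - m ^+ 2.
  rewrite /cov (@eq_sphere_mean _ _ sigma _ (fun x => G.[tnth x i] * G.[tnth x j] -
     (m * G.[tnth x i] + (m * G.[tnth x j] - m ^+ 2)))); last by move=> x _; ring.
  have bm k : sphere_bounded (fun x : T => m * G.[tnth x k]) by exact: sphere_boundedZ.
  have bc := @sphere_bounded_cst R n (m ^+ 2).
  have bmc k := sphere_boundedB (bm k) bc.
  rewrite sphere_meanB //; [|exact: sphere_boundedM|exact: sphere_boundedD].
  have mG k : E (fun x => m * G.[tnth x k]) = m * m.
    by rewrite (sphere_meanZ sigma m (bg k)) (mean_horner usigma n3 G k).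
  rewrite (sphere_meanD sigma (bm i) (bmc j)) (sphere_meanB sigma (bm j) bc).
  by rewrite (sphere_mean_cst sphere1) !mG; ring.
have -> : E (fun x => Y x ^+ 2) = \sum_i \sum_j (tnth a i ^+ 2 * tnth a j ^+ 2) * cov i j.
  rewrite (@eq_sphere_mean _ _ sigma _ (fun x => \sum_i \sum_j
     (tnth a i ^+ 2 * tnth a j ^+ 2) * ((G.[tnth x i] - m) * (G.[tnth x j] - m)))); last first.
    move=> x _; rewrite expr2 big_distrlr /=; apply: eq_bigr => i _; apply: eq_bigr => j _.
    by ring.
  rewrite sphere_mean_sum //; last first.
    by move=> i; apply: sphere_bounded_sum => j; apply: sphere_boundedZ; exact: sphere_boundedM.
  apply: eq_bigr => i _; rewrite sphere_mean_sum //; last first.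
    by move=> j; apply: sphere_boundedZ; exact: sphere_boundedM.
  by apply: eq_bigr => j _; rewrite sphere_meanZ //; exact: sphere_boundedM.
have V0 : 0 <= V by rewrite !mulr_ge0 ?exprn_ge0 ?prodr_ge0.
have C0 : 0 <= C by rewrite !mulr_ge0 ?exprn_ge0 ?prodr_ge0.
have covii i : cov i i <= V.
  rewrite covE; apply: (@le_trans _ _ (momentum n%:R (G ^+ 2))).
    rewrite -(mean_horner usigma n3 _ i).
    rewrite (@eq_sphere_mean _ _ sigma _ (fun x => (G ^+ 2).[tnth x i])).
      by rewrite gerBl sqr_ge0.
    by move=> x _; rewrite -hornerM -expr2.
  apply: (le_trans (ler_norm _)); rewrite /G expansion rescaled_poly_sqr.
  apply: momentum_rescaled_bound => //.
    by move=> t; rewrite normrM expr2; apply: ler_pM.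
  by move=> t; apply: leq_add; exact: ltnW.
have covij i j : i != j -> cov i j <= C / n%:R.
  move=> ij; rewrite covE; apply: (le_trans (ler_norm _)).
  by rewrite /m /G expansion; apply: rescaled_poly_covariance => // t; exact: ltnW.
(* Granting the diagonal the extra nonnegative term in C / n lets the weights a_i^2 a_j^2 run over
   all pairs, where they sum to 1. *)
apply: (@le_trans _ _ (\sum_i \sum_j ((i == j)%:R * (tnth a i ^+ 4 * V) +
    tnth a i ^+ 2 * tnth a j ^+ 2 * (C / n%:R)))).
  apply: ler_sum => i _; apply: ler_sum => j _.
  have [<-|ij] := eqVneq i j.
    have a4 : 0 <= tnth a i ^+ 4 by rewrite exprn_even_ge0.
    rewrite mul1r -exprD -[(2 + 2)%N]/4%N; apply: ler_wpDr; last exact: ler_wpM2l.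
    by rewrite mulr_ge0 // divr_ge0 // ltW.
  by rewrite mul0r add0r ler_wpM2l ?covij // mulr_ge0 // sqr_ge0.
rewrite (eq_bigr (fun i => tnth a i ^+ 4 * V + tnth a i ^+ 2 * (C / n%:R))); last first.
  move=> i _; rewrite big_split /=; congr (_ + _); last by rewrite -mulr_suml -mulr_sumr a1 mulr1.
  rewrite (bigD1 i) //= eqxx mul1r big1 ?addr0 // => j ji.
  by rewrite eq_sym (negbTE ji) mul0r.
rewrite big_split /= -!mulr_suml a1 mul1r -/s4 mulrDl mulrC lerD2l.
by rewrite ler_wpM2l.
Qed.

Lemma gradient_concentration :
  E (fun x => `|1 - lam^-1 * grad_sqr q a x|) <=
  ((V + C + 1) / 2 + 2 * (#|I|%:R * (K * odd_prod l))) * norm4sq a.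
Proof.
have e0 : 0 < norm4sq a.
  by rewrite /norm4sq sqrtr_gt0 -/s4 (lt_le_trans _ inv_n_s4) // invr_gt0.
have e2 : norm4sq a ^+ 2 = s4.
  by rewrite sqr_sqrtr // (le_trans _ inv_n_s4) // invr_ge0 ltW.
have e1 : norm4sq a <= 1 by rewrite -[leRHS]sqrtr1; exact: ler_wsqrtr.
set e := norm4sq a in e0 e1 e2 *.
have D0 : 0 <= #|I|%:R * (K * odd_prod l) by rewrite !mulr_ge0 ?prodr_ge0.
(* The mean of [B] is at most (V + C) e / 2 + e / 2 + 2 |delta|, because E Y^2 <= (V + C) e^2 and E
   U = delta. Finally |delta| = O(1/n), and 1/n <= e^2 <= e. *)
pose B (x : T) := ((e^-1 / 2) * Y x ^+ 2 + e / 2) + (`|delta| + U x).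
have bB1 : sphere_bounded (fun x : T => (e^-1 / 2) * Y x ^+ 2).
  by apply: sphere_boundedZ; exact: sphere_boundedX.
have bB2 : sphere_bounded (fun x : T => (e^-1 / 2) * Y x ^+ 2 + e / 2).
  by apply: sphere_boundedD => //; exact: sphere_bounded_cst.
have bB3 : sphere_bounded (fun x : T => `|delta| + U x).
  by apply: sphere_boundedD => //; exact: sphere_bounded_cst.
apply: (@le_trans _ _ (E B)).
  apply: le_sphere_mean => //.
  - apply: sphere_bounded_norm; apply: sphere_boundedB; first exact: sphere_bounded_cst.
    by apply: sphere_boundedZ; exact: sphere_bounded_grad_sqr.
  - exact: sphere_boundedD.
  move=> x sx.
  have -> : 1 - lam^-1 * grad_sqr q a x = - Y x - delta + U x.
    rewrite /grad_sqr mulrBr -/(U x).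
    have -> : lam^-1 * (\sum_i tnth a i ^+ 2 * q^`().[tnth x i] ^+ 2) = Y x + m.
      rewrite /Y; under [in RHS]eq_bigr do rewrite mulrBr.
      rewrite sumrB -mulr_suml a1 mul1r subrK mulr_sumr; apply: eq_bigr => i _.
      by rewrite /G hornerZ horner_exp mulrCA.
    by rewrite m_delta; ring.
  have U0 : 0 <= U x by rewrite mulr_ge0 ?sqr_ge0 // invr_ge0 ltW.
  have Yb : `|Y x| <= e^-1 / 2 * Y x ^+ 2 + e / 2.
    rewrite -[Y x ^+ 2]real_normK ?num_real // -subr_ge0.
    have -> : e^-1 / 2 * `|Y x| ^+ 2 + e / 2 - `|Y x| = e^-1 / 2 * (`|Y x| - e) ^+ 2.
      by move: (gt_eqF e0) => /negbT e0'; field.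
    by rewrite mulr_ge0 ?sqr_ge0 // divr_ge0 // invr_ge0 ltW.
  rewrite /B; apply: (le_trans (ler_normD _ _)); rewrite (ger0_norm U0) addrA lerD2r.
  by apply: (le_trans (ler_normB _ _)); rewrite normrN lerD2r.
rewrite /B sphere_meanD // sphere_meanD //; last exact: sphere_bounded_cst.
rewrite sphere_meanD //; last exact: sphere_bounded_cst.
rewrite (sphere_meanZ sigma _ (sphere_boundedX 2 bY)) !(sphere_mean_cst sphere1) EU.
have H1 : e^-1 / 2 * E (fun x => Y x ^+ 2) <= (V + C) / 2 * e.
  apply: (@le_trans _ _ (e^-1 / 2 * ((V + C) * s4))).
    by rewrite ler_wpM2l ?EY2 // divr_ge0 // invr_ge0 ltW.
  rewrite -e2 le_eqVlt; apply/orP; left; apply/eqP.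
  by move: (gt_eqF e0) => /negbT e0'; field.
have H2 : `|delta| <= #|I|%:R * (K * odd_prod l) * e.
  apply: (le_trans delta_bound); rewrite ler_wpM2l //.
  by apply: (le_trans inv_n_s4); rewrite -e2 expr2 ler_piMl // ltW.
have := ler_norm delta; rewrite mulrDl; lra.
Qed.

End gradient_concentration.

(** * Total variation bounds *)

Section final_bounds.
Context {R : realType}.

Lemma sphere_mean_total {n : nat} (sigma : probability (n.-tuple R) R) (f : n.-tuple R -> R) :
  sigma (sphere n) = 1%E -> sigma.-integrable setT (EFin \o f) ->
  \int[sigma]_x f x = sphere_mean sigma f.
Proof.
move=> sphere1 fi; rewrite /sphere_mean /Rintegral; congr fine.
have mS := @measurable_sphere R n.
rewrite (negligible_integral (measurableC mS) measurableT) //; first by rewrite setTD setCK.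
by have := probability_setC sigma mS; rewrite sphere1 subee.
Qed.

Lemma measurable_std_id : measurable_fun [set: measurableTypeR R] (fun t : measurableTypeR R => t : R).
Proof. by move=> _ A mA; rewrite setTI. Qed.

(* [normal_prob] lives on a copy of the measurable space [R]; its image under the identity is the
   same measure on [R] itself. *)
Definition std_id : {RV (normal_prob (0 : R) 1) >-> R} :=
  HB.pack (fun t : measurableTypeR R => t : R)
    (isMeasurableFun.Build _ _ _ _ _ measurable_std_id).

Definition std_law : probability R R := distribution (normal_prob 0 1) std_id.

Lemma Rintegral_std_law (h : R -> R) : measurable_fun setT h -> (forall t, `|h t| <= 1) ->
  \int[std_law]_t h t = \int[normal_prob (0 : R) 1]_t h t.
Proof.
move=> mh hb; rewrite /Rintegral /std_law; congr fine.
rewrite integral_distribution //; first exact/measurable_EFinP.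
exact: (@integrable_bounded _ _ _ _ _ 1).
Qed.

Lemma law_test_bound {n : nat} (sigma : probability (n.-tuple R) R) (W : n.-tuple R -> R) (e : R) :
  sigma (sphere n) = 1%E -> measurable_fun setT W ->
  (forall h, unit_continuous h ->
    `|sphere_mean sigma (fun x => h (W x)) - \int[normal_prob 0 1]_t h t| <= e) ->
  (dTV_gauss sigma W <= e%:E)%E.
Proof.
move=> sphere1 mW He.
pose X : {RV sigma >-> R} := HB.pack W (isMeasurableFun.Build _ _ _ _ W mW).
have test h : unit_continuous h ->
    `|\int[distribution sigma X]_t h t - \int[std_law]_t h t| <= e.
  move=> uh.
  have mh : measurable_fun setT h by exact: continuous_measurable_fun uh.1.
  have hb t : `|h t| <= 1 by have := uh.2 t; rewrite ler_norml; lra.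
  have hW : sigma.-integrable setT (EFin \o (fun x => h (W x))).
    by apply: (@integrable_bounded _ _ _ _ _ 1); first exact: measurableT_comp.
  have -> : \int[distribution sigma X]_t h t = sphere_mean sigma (fun x => h (W x)).
    rewrite -(sphere_mean_total sphere1 hW) /Rintegral; congr fine.
    by rewrite integral_distribution //; exact/measurable_EFinP.
  by rewrite Rintegral_std_law //; exact: He.
have key := continuous_test_measure test.
apply: ub_ereal_sup => _ [A mA <-].
have f1 : distribution sigma X A \is a fin_num by exact: fin_num_measure.
have f2 : std_law A \is a fin_num by exact: fin_num_measure.
rewrite -[X in (`|X - _| <= _)%E]/(distribution sigma X A) -[X in (`|_ - X| <= _)%E]/(std_law A).
by rewrite -(fineK f1) -(fineK f2) -EFinB abse_EFin lee_fin; exact: key.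
Qed.

(** [dTV_gauss] is a supremum over all Borel sets, and its measurability in [a] is not established.
    The integral of a nonnegative function is a supremum over the simple functions below it, and
    this is monotone. *)
Lemma ge0_le_integral_nonmeasurable (d : measure_display) (T : measurableType d)
    (mu : {measure set T -> \bar R}) (D : set T) (f1 f2 : T -> \bar R) :
  (forall x, D x -> 0 <= f1 x)%E -> (forall x, D x -> f1 x <= f2 x)%E ->
  (\int[mu]_(x in D) f1 x <= \int[mu]_(x in D) f2 x)%E.
Proof.
move=> f10 f12; rewrite !ge0_integralE //; last first.
  by move=> x Dx; apply: le_trans (f12 _ Dx); exact: f10.
apply: le_ereal_sup => _ [h hf <-]; exists h => // x.
by apply: le_trans (hf x) _; apply: lee_restrict.
Qed.

Lemma stein_bound {n l : nat} (sigma : probability (n.-tuple R) R) (a : n.-tuple R) :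
  (3 <= n)%N -> odd l -> uniform_sphere sigma ->
  (dTV_gauss sigma (p_comb l a) <= (2 * sphere_mean sigma (fun x =>
     `|1 - (harm_eigenvalue R n l)^-1 * grad_sqr (harm_poly R n l) a x|))%:E)%E.
Proof.
move=> n3 ol usigma; have sphere1 : sigma (sphere n) = 1%E by case: usigma.
set q := harm_poly R n l; set lam := harm_eigenvalue R n l.
have lam0 : 0 < lam by exact: harm_eigenvalue_gt0.
have -> : p_comb l a = coord_comb q a.
  by apply/funext => x; apply: eq_bigr => i _; rewrite p_harm_horner.
have bp := @sphere_bounded_coord_comb R n q a.
have bS := @sphere_bounded_grad_sqr R n q a.
apply: law_test_bound => //; first by case: bp.
move=> h uh; have [f [f' [df cf' f'2 fE]]] := stein_solution uh.
set c := \int[normal_prob 0 1]_t h t in fE *.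
have cf : continuous f by move=> w; exact: is_derive1_continuous (df w).
have bf : sphere_bounded (fun x : n.-tuple R => f (coord_comb q a x)) by exact: sphere_bounded_comp.
have bf' : sphere_bounded (fun x : n.-tuple R => f' (coord_comb q a x)) by exact: sphere_bounded_comp.
have bh : sphere_bounded (fun x : n.-tuple R => h (coord_comb q a x)).
  by apply: sphere_bounded_comp => //; case: uh.
have bfp := sphere_boundedM bf bp; have bf'S := sphere_boundedM bf' bS.
have b1S : sphere_bounded (fun x => 1 - lam^-1 * grad_sqr q a x).
  by apply: sphere_boundedB; [exact: sphere_bounded_cst|exact: sphere_boundedZ].
have -> : sphere_mean sigma (fun x => h (coord_comb q a x)) - c =
    sphere_mean sigma (fun x => f' (coord_comb q a x) * (1 - lam^-1 * grad_sqr q a x)).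
  transitivity (sphere_mean sigma (fun x => f' (coord_comb q a x)) -
     sphere_mean sigma (fun x => f (coord_comb q a x) * coord_comb q a x)).
    rewrite -(sphere_meanB sigma bf' bfp) -[c in LHS](sphere_mean_cst sphere1).
    rewrite -(sphere_meanB sigma bh (sphere_bounded_cst c)).
    by apply: eq_sphere_mean => x _; rewrite -fE mulrC.
  have SI := stein_identity usigma a (harm_poly_ode R n l) df cf'.
  have -> : sphere_mean sigma (fun x => f (coord_comb q a x) * coord_comb q a x) =
      sphere_mean sigma (fun x => lam^-1 * (f' (coord_comb q a x) * grad_sqr q a x)).
    by rewrite (sphere_meanZ sigma _ bf'S) -SI mulKf // gt_eqF.
  rewrite -(sphere_meanB sigma bf' (sphere_boundedZ lam^-1 bf'S)).
  by apply: eq_sphere_mean => x _; ring.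
have bprod := sphere_boundedM bf' b1S.
apply: (le_trans (sphere_mean_norm sigma bprod)).
rewrite -(sphere_meanZ sigma 2 (sphere_bounded_norm b1S)).
apply: le_sphere_mean.
- exact: sphere_bounded_norm.
- by apply: sphere_boundedZ; exact: sphere_bounded_norm.
- by move=> x _; rewrite normrM ler_wpM2r.
Qed.

Lemma dTV_norm4_bound (l : nat) : odd l ->
  exists2 c : R, 0 <= c & forall n, (3 <= n)%N ->
  forall sigma : probability (n.-tuple R) R, uniform_sphere sigma ->
  forall a : n.-tuple R, sphere n a ->
  (dTV_gauss sigma (p_comb l a) <= (c * norm4sq a)%:E)%E.
Proof.
move=> ol; have [K K0 HK] := deriv_harm_sqr_expansion R ol.
pose I := ('I_l./2.+1 * 'I_l./2.+1)%type.
pose V := #|{: I * I}|%:R * (K ^+ 2 * odd_prod (l + l)) : R.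
pose C := #|{: I * I}|%:R * (K ^+ 2 * (odd_prod l ^+ 2 * ((2 * l) ^ 2)%:R)) : R.
pose c := (V + C + 1) / 2 + 2 * (#|{: I}|%:R * (K * odd_prod l)) : R.
have O0 m : 0 <= odd_prod m :> R by apply: prodr_ge0.
have V0 : 0 <= V by rewrite !mulr_ge0 ?exprn_ge0.
have C0 : 0 <= C by rewrite !mulr_ge0 ?exprn_ge0.
have c0 : 0 <= c.
  apply: addr_ge0; last by rewrite !mulr_ge0.
  by rewrite divr_ge0 // !addr_ge0.
exists (2 * c); first by rewrite mulr_ge0.
move=> n n3 sigma usigma a a1; have [g gK expansion] := HK n n3.
apply: (le_trans (stein_bound a n3 ol usigma)); rewrite lee_fin -mulrA ler_wpM2l //.
apply: (@gradient_concentration R n l n3 ol sigma usigma _ g (fun t => l - 1 - t.1 - t.2)%N K) => //.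
by move=> t; lia.
Qed.

(** Each fourth moment is 3 / (n (n + 2)). *)
Lemma mean_norm4 {n : nat} (sigma : probability (n.-tuple R) R) :
  (3 <= n)%N -> uniform_sphere sigma ->
  sphere_mean sigma (fun a => \sum_i tnth a i ^+ 4) <= 3 / n%:R.
Proof.
move=> n3 usigma; have sphere1 : sigma (sphere n) = 1%E by case: usigma.
have n0 : 0 < n%:R :> R by rewrite ltr0n; lia.
rewrite sphere_mean_sum //; last by move=> i; apply: sphere_boundedX; exact: sphere_bounded_coord.
rewrite (eq_bigr (fun _ => 3 / (n%:R * (n%:R + 2)))) => [|i _].
  have n2 : 0 < n%:R + 2 :> R by rewrite addr_gt0.
  rewrite sumr_const card_ord -[_ *+ n]mulr_natl.
  have -> : n%:R * (3 / (n%:R * (n%:R + 2))) = 3 / (n%:R + 2) :> R.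
    by move: (gt_eqF n0) (gt_eqF n2) => /negbT h1 /negbT h2; field; apply/andP.
  by rewrite ler_wpM2l // lef_pV2 ?posrE // lerDl.
rewrite (mean_coord_even usigma n3 i 2) /odd_prod /dim_prod !big_ord_recl !big_ord0 /=.
by rewrite addr0 !mulr1 mul1r.
Qed.

End final_bounds.

Theorem theorem3p4 (R : realType) (l : nat) (hl : odd l) :
  (exists c : R, forall (n : nat), (3 <= n)%N ->
     forall sigma : probability (n.-tuple R) R, uniform_sphere sigma ->
     forall a : n.-tuple R, \sum_(i < n) tnth a i ^+ 2 = 1 ->
       (dTV_gauss sigma (p_comb l a) <= (c * norm4sq a)%:E)%E)
  /\
  (exists c' : R, forall (n : nat), (3 <= n)%N ->
     forall sigma : probability (n.-tuple R) R, uniform_sphere sigma ->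
       (\int[sigma]_(a in sphere n) dTV_gauss sigma (p_comb l a)
          <= (c' / Num.sqrt n%:R)%:E)%E).
Proof.
have [c c0 Hc] := @dTV_norm4_bound R l hl.
split; first by exists c.
(* With s = sqrt n, ||a||_4^2 <= (s/2) sum a_i^4 + 1/(2s) pointwise. The mean of the right side is
   at most (s/2)(3/n) + 1/(2s) = 2/s, hence the factor 2. *)
exists (2 * c) => n n3 sigma usigma.
have sphere1 : sigma (sphere n) = 1%E by case: usigma.
have n0 : 0 < n%:R :> R by rewrite ltr0n; lia.
pose s := Num.sqrt n%:R : R.
have s0 : 0 < s by rewrite sqrtr_gt0.
have s2 : s ^+ 2 = n%:R by rewrite sqr_sqrtr // ltW.
pose S (a : n.-tuple R) := \sum_i tnth a i ^+ 4.
pose b a := c * (s / 2 * S a + s^-1 / 2).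
have bS : sphere_bounded S.
  by apply: sphere_bounded_sum => i; apply: sphere_boundedX; exact: sphere_bounded_coord.
have bsS := sphere_boundedZ (s / 2) bS.
have bb1 := sphere_boundedD bsS (sphere_bounded_cst (s^-1 / 2)).
have bb : sphere_bounded b by exact: sphere_boundedZ.
apply: (@le_trans _ _ (\int[sigma]_(a in sphere n) (b a)%:E)%E).
  apply: ge0_le_integral_nonmeasurable => a sa.
    (* The supremum is nonnegative as soon as one set enters it; the full line serves. *)
    apply: (@le_trans _ _ `|sigma (p_comb l a @^-1` setT) - normal_prob 0 1 setT|%E).
      exact: abse_ge0.
    by apply: ereal_sup_ubound; exists setT => //; exact: measurableT.
  apply: (le_trans (Hc n n3 sigma usigma a sa)); rewrite lee_fin /b ler_wpM2l //.
  have S0 : 0 <= S a by apply: sumr_ge0 => i _; rewrite exprn_even_ge0.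
  have e2 : norm4sq a ^+ 2 = S a by rewrite sqr_sqrtr.
  rewrite -e2 -subr_ge0.
  have -> : s / 2 * norm4sq a ^+ 2 + s^-1 / 2 - norm4sq a = s / 2 * (norm4sq a - s^-1) ^+ 2.
    by move: (gt_eqF s0) => /negbT s0'; field.
  by rewrite mulr_ge0 ?sqr_ge0 // divr_ge0 // ltW.
have -> : (\int[sigma]_(a in sphere n) (b a)%:E)%E = (sphere_mean sigma b)%:E.
  rewrite fineK //; apply: integrable_fin_num; first exact: measurable_sphere.
  exact: sphere_bounded_integrable.
rewrite lee_fin /b (sphere_meanZ sigma c bb1).
rewrite (sphere_meanD sigma bsS (sphere_bounded_cst (s^-1 / 2))).
rewrite (sphere_meanZ sigma (s / 2) bS) (sphere_mean_cst sphere1).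
rewrite [2 * c]mulrC -[leRHS]mulrA ler_wpM2l //.
have H : s / 2 * sphere_mean sigma S <= s / 2 * (3 / n%:R).
  by rewrite ler_wpM2l ?mean_norm4 // divr_ge0 // ltW.
have -> : 2 / s = s / 2 * (3 / n%:R) + s^-1 / 2.
  by rewrite -s2; move: (gt_eqF s0) => /negbT s0'; field.
by rewrite lerD2r.
Qed.
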